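(* Suppose $p=\beta\log N$ with $\beta$ large enough that $\|CA_K^p\|\,\|\Sigma_{x,N}\|\le N^{-3}$, and suppose $$\|W_1\hat{\mathcal H}_{fp}W_2-W_1\mathcal H_{fp}W_2\|\le\frac{\sigma_{n_x}(W_1\mathcal H_{fp}W_2)}{4}.$$ Then there exists an orthogonal matrix $T$ such that, for a failure probability $0<\delta<1$, if $N\ge\max_{1\le i\le f}N_{pe}\big(\tfrac{\delta}{9f},\beta\log N,i\big)$, then with probability at least $1-2\delta$, $$\|\hat\Gamma_f-\bar\Gamma_fT\|\le\sqrt{\frac{40n_x}{\sigma_{n_x}(\mathcal H_{fp})}}\,\|\hat{\mathcal H}_{fp}-\mathcal H_{fp}\|\,W_\Gamma,\qquad \|\hat L_p-T^\top\bar L_p\|\le\sqrt{\frac{40n_x}{\sigma_{n_x}(\mathcal H_{fp})}}\,\|\hat{\mathcal H}_{fp}-\mathcal H_{fp}\|\,W_L,$$ where $W_\Gamma=\|W_1\|\|W_2\|\|W_1^{-1}\|^{3/2}\|W_2^{-1}\|^{1/2}$ and $W_L=\|W_1\|\|W_2\|\|W_2^{-1}\|^{3/2}\|W_1^{-1}\|^{1/2}$.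
   Context: System: $x_{k+1}=Ax_k+Bu_k+K\Sigma_e^{1/2}e_k$, $y_k=Cx_k+\Sigma_e^{1/2}e_k$ for $k\ge1$, with $x_1=0$, $x_k\in\mathbb{R}^{n_x}$, $u_k\in\mathbb{R}^{n_u}$, $y_k,e_k\in\mathbb{R}^{n_y}$, $\Sigma_e\succ0$. Standing assumptions: $\rho(A)<1$, $\rho(A_K)<1$ with $A_K=A-KC$; $(A,[B\ K])$ controllable, $(A,C)$ observable; $e_k$ i.i.d. $\mathcal N(0,I)$; $u_k$ i.i.d. $\mathcal N(0,\sigma_u^2I)$ independent of $\{e_k\}$. Data available for $k=1,\dots,N+p+f-1$. $\Sigma_{x,k}=\mathbb{E}[x_kx_k^\top]$. Hankel-like matrix: $\Gamma_f=[C^\top,(CA)^\top,\dots,(CA^{f-1})^\top]^\top$, $L_p=[A_K^{p-1}K,\dots,K,A_K^{p-1}B,\dots,B]$, $\mathcal H_{fp}=\Gamma_fL_p$, which has rank $n_x$. Estimate: with $u_p(k)=[u_k^\top,\dots,u_{k+p-1}^\top]^\top$, $y_p(k)$ analogously, $u_i(k)=[u_{k+p}^\top,\dots,u_{k+p+i-1}^\top]^\top$, $\phi_{p,i}(k)=[y_p(k)^\top,u_p(k)^\top,u_i(k)^\top]^\top$, $\Phi_{p,i}=[\phi_{p,i}(1),\dots,\phi_{p,i}(N)]$, $Y_{fi}=[y_{p+i},\dots,y_{p+i+N-1}]$, set $\hat\Theta_i=Y_{fi}\Phi_{p,i}^\dagger$; $\hat{\mathcal H}_{fp}$ is the vertical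 stack over $i=1,\dots,f$ of the first $p(n_y+n_u)$ columns of $\hat\Theta_i$. Weighted SVD: $W_1\in\mathbb{R}^{fn_y\times fn_y}$, $W_2\in\mathbb{R}^{p(n_y+n_u)\times p(n_y+n_u)}$ are (possibly data-dependent) weighting matrices, assumed almost surely positive definite. Write $W_1\hat{\mathcal H}_{fp}W_2=\hat U\hat\Lambda\hat V^\top$ and let $\hat U_1,\hat\Lambda_1,\hat V_1$ correspond to the $n_x$ largest singular values; $\hat\Gamma_f=W_1^{-1}\hat U_1\hat\Lambda_1^{1/2}$, $\hat L_p=\hat\Lambda_1^{1/2}\hat V_1^\top W_2^{-1}$. Likewise $W_1\mathcal H_{fp}W_2=U_1\Lambda_1V_1^\top$ (compact SVD, $\Lambda_1\succ0$ of size $n_x$), $\bar\Gamma_f=W_1^{-1}U_1\Lambda_1^{1/2}$, $\bar L_p=\Lambda_1^{1/2}V_1^\top W_2^{-1}$. Burn-in time: for $1\le i\le f$, $d_{p,i}=p(n_u+n_y)+in_u$; $G_p$: $p\times p$ block lower-triangular Toeplitz, zero diagonal blocks, $(r,c)$ block $CA^{r-c-1}B$ for $r>c$; $H_p$: same with $B$ replaced by $K\Sigma_e^{1/2}$ and diagonal blocks $\Sigma_e^{1/2}$; $\mathcal{T}_{p,i}=\begin{bmatrix}G_p&0&H_p\\ I&0&0\\0&I&0\end{bmatrix}$, $\Lambda_{u,e}=\mathrm{diag}(\sigma_uI_{(p+i)n_u},I_{pn_y})$, $\bar\sigma_{p,i}=\|\mathcal{T}_{p,i}\|\|\Lambda_{u,e}\|/2$;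 $\bar u=n_u\sqrt{2n_u\log(32n_uN/\delta)}$, $\bar e=n_y\sqrt{2n_y\log(32n_yN/\delta)}$, $\bar w_{p,i}=\bar e\sqrt p+\bar u\sqrt{p+i}$, $\bar r_{p,i}=2\bar w_{p,i}^2\sqrt{2\log(d_{p,i}/\delta)}$, $N_W(\delta,p,i)=4\bar r_{p,i}^2$; $C_{i,XE}=4\log\det(I+\tfrac{2n_x}{\delta}\Sigma_{x,N})+8\log\frac{2\cdot5^{d_{p,i}}}{\delta}$, $\gamma_{i,N}=2\|\mathcal{T}_{p,i}\|\|\Lambda_{u,e}\|\sqrt{C_{i,XE}/N}$, $N_\Phi(\delta,p,i)=\min\{N:\gamma_{i,N}\le\min\{1,\bar\sigma_{p,i}^2\}\}$; $N_{pe}(\delta,p,i)=\min\{N:N\ge N_W(\delta,p,i),\ N\ge N_\Phi(\delta,p,i)\}$. *)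

(* Defs.v *)
From HB Require Import structures.
From mathcomp Require Import all_boot all_order all_algebra.
From mathcomp Require Import all_classical all_reals all_analysis.
From mathcomp Require Import complex.

Set Implicit Arguments.
Unset Strict Implicit.
Unset Printing Implicit Defensive.

Import Order.TTheory GRing.Theory Num.Theory.
Local Open Scope classical_set_scope.
Local Open Scope ring_scope.

(* entry (i,j) of M addressed by natural numbers (0 outside the range) *)
Definition mx_at {R : pzRingType} m n (M : 'M[R]_(m, n)) (i j : nat) : R :=
  match @insub _ (fun k => k < m)%N _ i, @insub _ (fun k => k < n)%N _ j with
  | Some a, Some b => M a b
  | _, _ => 0
  end.

Definition vnorm {R : realType} n (v : 'cV[R]_n) : R :=
  Num.sqrt (\sum_(i < n) v i 0 ^+ 2).

Definition opnorm {R : realType} m n (M : 'M[R]_(m, n)) : R :=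
  sup [set r | exists x : 'cV[R]_n, vnorm x <= 1 /\ r = vnorm (M *m x)].

Definition orthogonal_mx {R : pzRingType} n (Q : 'M[R]_n) : Prop :=
  Q^T *m Q = 1%:M.

Definition sym_mx {R : pzRingType} n (M : 'M[R]_n) : Prop := M^T = M.

Definition posdef_mx {R : realType} n (M : 'M[R]_n) : Prop :=
  sym_mx M /\ forall x : 'cV[R]_n, x != 0 -> 0 < (x^T *m M *m x) 0 0.

Definition rdiag_mx {R : pzRingType} m n (s : nat -> R) : 'M[R]_(m, n) :=
  \matrix_(i, j) (if (i : nat) == j then s i else 0).

Definition is_svd {R : realType} m n (M : 'M[R]_(m, n))
    (U : 'M[R]_m) (s : nat -> R) (V : 'M[R]_n) : Prop :=
  [/\ orthogonal_mx U, orthogonal_mx V,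
      (forall k, 0 <= s k /\ s k.+1 <= s k),
      (forall k, (minn m n <= k)%N -> s k = 0) &
      M = U *m rdiag_mx m n s *m V^T].

(* k-th largest singular value sigma_k(M) (1-indexed, as in the paper) *)
Definition singval {R : realType} m n (M : 'M[R]_(m, n)) (k : nat) : R :=
  xget 0 [set r | exists U s V, is_svd M U s V /\ s k.-1 = r].

Definition firstcols_mx {R : pzRingType} m n r (M : 'M[R]_(m, n)) : 'M[R]_(m, r) :=
  \matrix_(i, j) mx_at M i j.

Definition sqdiag_mx {R : pzRingType} r (g : nat -> R) : 'M[R]_r :=
  \matrix_(i, j) (if i == j then g i else 0).

Definition is_mppinv {R : pzRingType} m n (M : 'M[R]_(m, n)) (X : 'M[R]_(n, m)) :=
  [/\ M *m X *m M = M, X *m M *m X = X, (M *m X)^T = M *m X & (X *m M)^T = X *m M].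

Definition mppinv {R : realType} m n (M : 'M[R]_(m, n)) : 'M[R]_(n, m) :=
  xget 0 (is_mppinv M).

Definition schur_stable {R : rcfType} n (M : 'M[R]_n) : Prop :=
  forall z : R[i], eigenvalue (map_mx (fun r : R => (r%:C)%C) M) z -> `|z| < 1.

Definition ctrb_mx {R : pzRingType} n m (A : 'M[R]_n) (Bm : 'M[R]_(n, m)) :
    'M[R]_(n, n * m) :=
  \matrix_(r, c) mx_at (A ^+ (c %/ m) *m Bm) r (c %% m).

Definition obsv_mx {R : pzRingType} n q (f : nat) (C : 'M[R]_(q, n)) (A : 'M[R]_n) :
    'M[R]_(f * q, n) :=
  \matrix_(r, c) mx_at (C *m A ^+ (r %/ q)) (r %% q) c.

Definition controllable {R : fieldType} n m (A : 'M[R]_n) (Bm : 'M[R]_(n, m)) :=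
  \rank (ctrb_mx A Bm) = n.

Definition observable {R : fieldType} n q (A : 'M[R]_n) (C : 'M[R]_(q, n)) :=
  \rank (obsv_mx n C A) = n.

Definition Gammaf {R : pzRingType} nx ny (f : nat) (A : 'M[R]_nx) (C : 'M[R]_(ny, nx)) :
  'M[R]_(f * ny, nx) := obsv_mx f C A.

(* L_p = [A_K^{p-1} K, ..., K, A_K^{p-1} B, ..., B],  A_K = A - K C *)
Definition Lp {R : pzRingType} nx nu ny (p : nat) (A : 'M[R]_nx) (B : 'M[R]_(nx, nu))
    (C : 'M[R]_(ny, nx)) (K : 'M[R]_(nx, ny)) : 'M[R]_(nx, p * (ny + nu)) :=
  let AK := A - K *m C in
  \matrix_(r, c)
    if ((c : nat) < p * ny)%N then mx_at (AK ^+ (p - 1 - c %/ ny) *m K) r (c %% ny)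
    else mx_at (AK ^+ (p - 1 - (c - p * ny) %/ nu) *m B) r ((c - p * ny) %% nu).

Definition Hfp {R : pzRingType} nx nu ny (f p : nat) (A : 'M[R]_nx) (B : 'M[R]_(nx, nu))
    (C : 'M[R]_(ny, nx)) (K : 'M[R]_(nx, ny)) : 'M[R]_(f * ny, p * (ny + nu)) :=
  Gammaf f A C *m Lp p A B C K.

Definition vec_of {Om : Type} {R : pzRingType} n (w : nat -> 'I_n -> Om -> R)
    (k : nat) (om : Om) : 'cV[R]_n :=
  \col_j w k j om.

(* sys_state: x_1 = 0, x_{k+1} = A x_k + B u_k + K S e_k   (S = Sigma_e^{1/2});
   index 0 is unused and set to 0 *)
Fixpoint sys_state {Om : Type} {R : pzRingType} nx nu ny (A : 'M[R]_nx) (B : 'M[R]_(nx, nu))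
    (K : 'M[R]_(nx, ny)) (S : 'M[R]_ny)
    (e : nat -> 'I_ny -> Om -> R) (u : nat -> 'I_nu -> Om -> R)
    (k : nat) (om : Om) : 'cV[R]_nx :=
  match k with
  | 0 => 0
  | k'.+1 =>
      match k' with
      | 0 => 0
      | _.+1 => A *m sys_state A B K S e u k' om + B *m vec_of u k' om
                + K *m S *m vec_of e k' om
      end
  end.

Definition sys_output {Om : Type} {R : pzRingType} nx nu ny (A : 'M[R]_nx) (B : 'M[R]_(nx, nu))
    (C : 'M[R]_(ny, nx)) (K : 'M[R]_(nx, ny)) (S : 'M[R]_ny)
    (e : nat -> 'I_ny -> Om -> R) (u : nat -> 'I_nu -> Om -> R)
    (k : nat) (om : Om) : 'cV[R]_ny :=
  C *m sys_state A B K S e u k om + S *m vec_of e k om.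

Definition Sigmax {d} {Om : measurableType d} {R : realType} (P : probability Om R)
    nx nu ny (A : 'M[R]_nx) (B : 'M[R]_(nx, nu)) (K : 'M[R]_(nx, ny)) (S : 'M[R]_ny)
    (e : nat -> 'I_ny -> Om -> R) (u : nat -> 'I_nu -> Om -> R) (k : nat) : 'M[R]_nx :=
  \matrix_(a, b) fine (expectation P
     (fun om => sys_state A B K S e u k om a 0 * sys_state A B K S e u k om b 0)).

(* Phi_{p,i} = [phi_{p,i}(1), ..., phi_{p,i}(N)],
   phi_{p,i}(k) = [y_p(k); u_p(k); u_i(k)] *)
Definition Phi_mx {Om : Type} {R : pzRingType} nx nu ny (A : 'M[R]_nx) (B : 'M[R]_(nx, nu))
    (C : 'M[R]_(ny, nx)) (K : 'M[R]_(nx, ny)) (S : 'M[R]_ny)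
    (e : nat -> 'I_ny -> Om -> R) (u : nat -> 'I_nu -> Om -> R)
    (N p i : nat) (om : Om) : 'M[R]_(p * ny + p * nu + i * nu, N) :=
  \matrix_(r, c)
    let k := (c : nat).+1 in
    if ((r : nat) < p * ny)%N then
      mx_at (sys_output A B C K S e u (k + r %/ ny) om) (r %% ny) 0
    else if ((r : nat) < p * ny + p * nu)%N then
      mx_at (vec_of u (k + (r - p * ny) %/ nu) om) ((r - p * ny) %% nu) 0
    else
      mx_at (vec_of u (k + p + (r - (p * ny + p * nu)) %/ nu) om)
          ((r - (p * ny + p * nu)) %% nu) 0.

Definition Yfi {Om : Type} {R : pzRingType} nx nu ny (A : 'M[R]_nx) (B : 'M[R]_(nx, nu))
    (C : 'M[R]_(ny, nx)) (K : 'M[R]_(nx, ny)) (S : 'M[R]_ny)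
    (e : nat -> 'I_ny -> Om -> R) (u : nat -> 'I_nu -> Om -> R)
    (N p i : nat) (om : Om) : 'M[R]_(ny, N) :=
  \matrix_(r, c) sys_output A B C K S e u (p + i + c) om r 0.

Definition Thetahat {Om : Type} {R : realType} nx nu ny (A : 'M[R]_nx)
    (B : 'M[R]_(nx, nu)) (C : 'M[R]_(ny, nx)) (K : 'M[R]_(nx, ny)) (S : 'M[R]_ny)
    (e : nat -> 'I_ny -> Om -> R) (u : nat -> 'I_nu -> Om -> R)
    (N p i : nat) (om : Om) : 'M[R]_(ny, p * ny + p * nu + i * nu) :=
  Yfi A B C K S e u N p i om *m mppinv (Phi_mx A B C K S e u N p i om).

(* hat H_fp : vertical stack over i = 1..f of the first p(ny+nu) columns
   of hat Theta_i *)
Definition Hhat {Om : Type} {R : realType} nx nu ny (A : 'M[R]_nx)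
    (B : 'M[R]_(nx, nu)) (C : 'M[R]_(ny, nx)) (K : 'M[R]_(nx, ny)) (S : 'M[R]_ny)
    (e : nat -> 'I_ny -> Om -> R) (u : nat -> 'I_nu -> Om -> R)
    (N f p : nat) (om : Om) : 'M[R]_(f * ny, p * (ny + nu)) :=
  \matrix_(r, c) mx_at (Thetahat A B C K S e u N p (r %/ ny).+1 om) (r %% ny) c.

Definition d_pi (nu ny p i : nat) : nat := (p * (nu + ny) + i * nu)%N.

Definition Gp_mx {R : pzRingType} nx nu ny (p : nat) (A : 'M[R]_nx) (B : 'M[R]_(nx, nu))
    (C : 'M[R]_(ny, nx)) : 'M[R]_(p * ny, p * nu) :=
  \matrix_(a, b)
    if ((b : nat) %/ nu < (a : nat) %/ ny)%N then
      mx_at (C *m A ^+ ((a %/ ny) - (b %/ nu) - 1) *m B) (a %% ny) (b %% nu)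
    else 0.

Definition Hp_mx {R : pzRingType} nx ny (p : nat) (A : 'M[R]_nx)
    (C : 'M[R]_(ny, nx)) (K : 'M[R]_(nx, ny)) (S : 'M[R]_ny) : 'M[R]_(p * ny, p * ny) :=
  \matrix_(a, b)
    if ((b : nat) %/ ny < (a : nat) %/ ny)%N then
      mx_at (C *m A ^+ ((a %/ ny) - (b %/ ny) - 1) *m K *m S) (a %% ny) (b %% ny)
    else if ((b : nat) %/ ny == (a : nat) %/ ny)%N then mx_at S (a %% ny) (b %% ny)
    else 0.

Definition Tpi {R : pzRingType} nx nu ny (p i : nat) (A : 'M[R]_nx) (B : 'M[R]_(nx, nu))
    (C : 'M[R]_(ny, nx)) (K : 'M[R]_(nx, ny)) (S : 'M[R]_ny) :
    'M[R]_(p * ny + (p * nu + i * nu), p * nu + i * nu + p * ny) :=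
  col_mx (row_mx (row_mx (Gp_mx p A B C) 0) (Hp_mx p A C K S))
         (col_mx (row_mx (row_mx 1%:M 0) 0) (row_mx (row_mx 0 1%:M) 0)).

Definition Lambdaue {R : pzRingType} nu ny (p i : nat) (su : R) :
    'M[R]_(p * nu + i * nu + p * ny) :=
  block_mx (su%:M : 'M[R]_(p * nu + i * nu)) 0 0 (1%:M : 'M[R]_(p * ny)).

Definition sigmabar {R : realType} nx nu ny (p i : nat) (A : 'M[R]_nx)
    (B : 'M[R]_(nx, nu)) (C : 'M[R]_(ny, nx)) (K : 'M[R]_(nx, ny)) (S : 'M[R]_ny)
    (su : R) : R :=
  opnorm (Tpi p i A B C K S) * opnorm (Lambdaue nu ny p i su) / 2.

Definition ubar {R : realType} (nu N : nat) (delta : R) : R :=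
  nu%:R * Num.sqrt (2 * nu%:R * ln (32 * nu%:R * N%:R / delta)).

Definition ebar {R : realType} (ny N : nat) (delta : R) : R :=
  ny%:R * Num.sqrt (2 * ny%:R * ln (32 * ny%:R * N%:R / delta)).

Definition wbar {R : realType} (nu ny N p i : nat) (delta : R) : R :=
  ebar ny N delta * Num.sqrt p%:R + ubar nu N delta * Num.sqrt (p + i)%:R.

Definition rbar {R : realType} (nu ny N p i : nat) (delta : R) : R :=
  2 * wbar nu ny N p i delta ^+ 2 * Num.sqrt (2 * ln ((d_pi nu ny p i)%:R / delta)).

(* N_W(delta,p,i); it depends on the sample size N through ubar, ebar *)
Definition N_W {R : realType} (nu ny N p i : nat) (delta : R) : R :=
  4 * rbar nu ny N p i delta ^+ 2.

Definition CXE {d} {Om : measurableType d} {R : realType} (P : probability Om R)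
    nx nu ny (A : 'M[R]_nx) (B : 'M[R]_(nx, nu)) (K : 'M[R]_(nx, ny)) (S : 'M[R]_ny)
    (e : nat -> 'I_ny -> Om -> R) (u : nat -> 'I_nu -> Om -> R)
    (N p i : nat) (delta : R) : R :=
  4 * ln (\det (1%:M + (2 * nx%:R / delta) *: Sigmax P A B K S e u N))
  + 8 * ln (2 * 5 ^+ d_pi nu ny p i / delta).

Definition gammaN {d} {Om : measurableType d} {R : realType} (P : probability Om R)
    nx nu ny (A : 'M[R]_nx) (B : 'M[R]_(nx, nu)) (C : 'M[R]_(ny, nx))
    (K : 'M[R]_(nx, ny)) (S : 'M[R]_ny) (su : R)
    (e : nat -> 'I_ny -> Om -> R) (u : nat -> 'I_nu -> Om -> R)
    (N p i : nat) (delta : R) : R :=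
  2 * opnorm (Tpi p i A B C K S) * opnorm (Lambdaue nu ny p i su)
  * Num.sqrt (CXE P A B K S e u N p i delta / N%:R).

(* "n >= min S" for a set S of positive integers, unfolded:
   some element of S is <= n (false if S is empty, i.e. min S = +oo) *)
Definition nat_ge_min (n : nat) (S : set nat) : Prop :=
  exists2 m, S m & (m <= n)%N.

(* N_Phi(delta,p,i) = min{N : gamma_{i,N} <= min{1, sigmabar^2}} *)
Definition NPhi_set {d} {Om : measurableType d} {R : realType} (P : probability Om R)
    nx nu ny (A : 'M[R]_nx) (B : 'M[R]_(nx, nu)) (C : 'M[R]_(ny, nx))
    (K : 'M[R]_(nx, ny)) (S : 'M[R]_ny) (su : R)
    (e : nat -> 'I_ny -> Om -> R) (u : nat -> 'I_nu -> Om -> R)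
    (p i : nat) (delta : R) : set nat :=
  [set M | (0 < M)%N /\
     gammaN P A B C K S su e u M p i delta
       <= Num.min 1 (sigmabar p i A B C K S su ^+ 2)].

(* N_pe(delta,p,i) = min{N : N >= N_W(delta,p,i), N >= N_Phi(delta,p,i)} *)
Definition Npe_set {d} {Om : measurableType d} {R : realType} (P : probability Om R)
    nx nu ny (A : 'M[R]_nx) (B : 'M[R]_(nx, nu)) (C : 'M[R]_(ny, nx))
    (K : 'M[R]_(nx, ny)) (S : 'M[R]_ny) (su : R)
    (e : nat -> 'I_ny -> Om -> R) (u : nat -> 'I_nu -> Om -> R)
    (p i : nat) (delta : R) : set nat :=
  [set M | (0 < M)%N /\ N_W nu ny M p i delta <= M%:R /\
     nat_ge_min M (NPhi_set P A B C K S su e u p i delta)].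

Definition mutually_independent {d} {Om : measurableType d} {R : realType}
    (P : probability Om R) (I : eqType) (X : I -> Om -> R) (D : set I) : Prop :=
  forall (J : seq I) (Bs : I -> set R),
    uniq J -> (forall j, j \in J -> D j) -> (forall j, measurable (Bs j)) ->
    P (\bigcap_(j in [set` J]) (X j @^-1` Bs j)) =
    (\prod_(j <- J) fine (P (X j @^-1` Bs j)))%:E.

Definition has_normal_law {d} {Om : measurableType d} {R : realType}
    (P : probability Om R) (X : {RV P >-> R}) (m s : R) : Prop :=
  forall Bs : set R, measurable Bs -> distribution P X Bs = normal_prob m s Bs.

(* Main.v *)
Require Import Defs.
From HB Require Import structures.
From mathcomp Require Import all_boot all_order all_algebra.
From mathcomp Require Import all_classical all_reals all_analysis.
From mathcomp Require Import ring lra.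

Import Order.TTheory GRing.Theory Num.Theory.
Import numFieldNormedType.Exports.
Local Open Scope classical_set_scope.
Local Open Scope ring_scope.

Set Implicit Arguments.
Unset Strict Implicit.
Unset Printing Implicit Defensive.

(** The bounds hold on the almost sure event where both weights are positive
    definite. Let [M = W1 H W2] and [Mh = W1 Hh W2], with balanced factors
    [Z = col_mx (U1 l^(1/2)) (V1 l^(1/2))] and, from the truncated SVD of [Mh],
    [Zh]. The rotation [T] is the orthogonal polar factor of [Z^T Zh]; then
    [(Z T)^T Zh] is positive semidefinite, and completing a square gives
    [min l * |Zh - Z T|_F^2 <= 3/4 * |Zh Zh^T - Z Z^T|_F^2]. The right-hand
    side is at most [3 * |Mh_q - M|_F^2], where [Mh_q] is the truncation of
    [Mh] to rank [q = n_x], and [|Mh_q - M|_F^2 <= 5 q |Mh - M|^2] since the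
    [q+1]-st singular value of [Mh] is at most [|Mh - M|]. Finally
    [sigma_q(H) <= |W1^-1| |W2^-1| min l] by Courant-Fischer. *)

(** * Frobenius and operator norms *)

Section FrobeniusNorm.
Context {R : realType}.

(** The squared Frobenius norm, in trace form so that orthogonal invariance and the expansion of
    sums become trace identities. On column vectors it is the squared Euclidean norm. *)
Definition fro2 m n (M : 'M[R]_(m, n)) : R := \tr (M^T *m M).

Lemma fro2E m n (M : 'M[R]_(m, n)) : fro2 M = \sum_j \sum_i M i j ^+ 2.
Proof.
apply: eq_bigr => j _; rewrite mxE; apply: eq_bigr => i _.
by rewrite mxE expr2.
Qed.

Lemma fro2_ge0 m n (M : 'M[R]_(m, n)) : 0 <= fro2 M.
Proof. by rewrite fro2E; do 2! apply: sumr_ge0 => ? _; exact: sqr_ge0. Qed.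

Lemma fro2_eq0 m n (M : 'M[R]_(m, n)) : (fro2 M == 0) = (M == 0).
Proof.
apply/idP/eqP => [|->]; last by rewrite /fro2 mulmx0 mxtrace0.
rewrite fro2E psumr_eq0 => [/allP Mj0|j _]; last first.
  by apply: sumr_ge0 => ? _; exact: sqr_ge0.
apply/matrixP => i j; rewrite mxE.
have := Mj0 j (mem_index_enum j); rewrite psumr_eq0 => [/allP Mi0|k _]; last exact: sqr_ge0.
by have := Mi0 i (mem_index_enum i); rewrite sqrf_eq0 => /eqP.
Qed.

Lemma fro20 m n : fro2 (0 : 'M[R]_(m, n)) = 0.
Proof. by apply/eqP; rewrite fro2_eq0. Qed.

Lemma fro2_gt0 m n (M : 'M[R]_(m, n)) : M != 0 -> 0 < fro2 M.
Proof. by move=> M0; rewrite lt_def fro2_eq0 M0 fro2_ge0. Qed.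

Lemma fro2_tr m n (M : 'M[R]_(m, n)) : fro2 M^T = fro2 M.
Proof. by rewrite /fro2 trmxK mxtrace_mulC. Qed.

Lemma fro2_isom m n k (U : 'M[R]_(m, n)) (M : 'M[R]_(n, k)) :
  U^T *m U = 1%:M -> fro2 (U *m M) = fro2 M.
Proof. by move=> UU; rewrite /fro2 trmx_mul mulmxA -(mulmxA M^T) UU mulmx1. Qed.

Lemma fro2_isomr m n k (U : 'M[R]_(m, n)) (M : 'M[R]_(k, n)) :
  U^T *m U = 1%:M -> fro2 (M *m U^T) = fro2 M.
Proof. by move=> UU; rewrite -fro2_tr trmx_mul trmxK fro2_isom // fro2_tr. Qed.

Lemma mxtrace_tr_mulC m n (X Y : 'M[R]_(m, n)) : \tr (Y^T *m X) = \tr (X^T *m Y).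
Proof. by rewrite -mxtrace_tr trmx_mul trmxK. Qed.

Lemma fro2D m n (X Y : 'M[R]_(m, n)) :
  fro2 (X + Y) = fro2 X + fro2 Y + 2 * \tr (X^T *m Y).
Proof.
rewrite /fro2 [(X + Y)^T]linearD /= mulmxDl !mulmxDr !mxtraceD (mxtrace_tr_mulC X Y).
by ring.
Qed.

Lemma fro2N m n (X : 'M[R]_(m, n)) : fro2 (- X) = fro2 X.
Proof. by rewrite /fro2 [(- X)^T]linearN /= mulNmx mulmxN opprK. Qed.

Lemma fro2B m n (X Y : 'M[R]_(m, n)) :
  fro2 (X - Y) = fro2 X + fro2 Y - 2 * \tr (X^T *m Y).
Proof. by rewrite fro2D fro2N mulmxN linearN /=; ring. Qed.

Lemma fro2Z m n a (X : 'M[R]_(m, n)) : fro2 (a *: X) = a ^+ 2 * fro2 X.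
Proof. by rewrite /fro2 [(a *: X)^T]linearZ /= -scalemxAl -scalemxAr !mxtraceZ expr2 mulrA. Qed.

Lemma fro2_col_mx m1 m2 n (X : 'M[R]_(m1, n)) (Y : 'M[R]_(m2, n)) :
  fro2 (col_mx X Y) = fro2 X + fro2 Y.
Proof. by rewrite /fro2 tr_col_mx mul_row_col mxtraceD. Qed.

Lemma fro2_row_mx m n1 n2 (X : 'M[R]_(m, n1)) (Y : 'M[R]_(m, n2)) :
  fro2 (row_mx X Y) = fro2 X + fro2 Y.
Proof. by rewrite -fro2_tr tr_row_mx fro2_col_mx !fro2_tr. Qed.

Lemma fro2_cols m n (M : 'M[R]_(m, n)) : fro2 M = \sum_j fro2 (col j M).
Proof.
rewrite fro2E; apply: eq_bigr => j _; rewrite fro2E big_ord1.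
by apply: eq_bigr => i _; rewrite mxE.
Qed.

Lemma fro2_rows m n (M : 'M[R]_(m, n)) : fro2 M = \sum_i fro2 (row i M).
Proof. by rewrite -fro2_tr fro2_cols; apply: eq_bigr => i _; rewrite -tr_row fro2_tr. Qed.

Lemma col_mulmx m n k j (X : 'M[R]_(m, n)) (Y : 'M[R]_(n, k)) :
  col j (X *m Y) = X *m col j Y.
Proof. by rewrite !colE mulmxA. Qed.

(** Expand [|a X - t Y|^2 >= 0] with [a = |Y|^2] and [t = <X, Y>], then cancel a factor [a]. *)
Lemma fro2_CauchySchwarz m n (X Y : 'M[R]_(m, n)) :
  \tr (X^T *m Y) ^+ 2 <= fro2 X * fro2 Y.
Proof.
have [->|Y0] := eqVneq Y 0; first by rewrite fro20 mulr0 mulmx0 mxtrace0 expr0n.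
have := fro2_ge0 (fro2 Y *: X - \tr (X^T *m Y) *: Y).
rewrite fro2B !fro2Z [(fro2 Y *: X)^T]linearZ /= -scalemxAl -scalemxAr !mxtraceZ.
have := fro2_gt0 Y0; set a := fro2 Y; set b := fro2 X; set t := \tr _ => a0.
have -> : a ^+ 2 * b + t ^+ 2 * a - 2 * (a * (t * t)) = a * (b * a - t ^+ 2) by ring.
by rewrite pmulr_rge0 // subr_ge0.
Qed.

(** Entry [(i, j)] of the product pairs row [i] of [X] with column [j] of [Y], so Cauchy-Schwarz
    applies entry by entry. *)
Lemma fro2M m n k (X : 'M[R]_(m, n)) (Y : 'M[R]_(n, k)) :
  fro2 (X *m Y) <= fro2 X * fro2 Y.
Proof.
rewrite (fro2_cols Y) mulr_sumr fro2_cols; apply: ler_sum => j _.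
rewrite (fro2_rows X) mulr_suml fro2_rows; apply: ler_sum => i _.
rewrite col_mulmx row_mul -(fro2_tr (row i X)).
apply: le_trans (fro2_CauchySchwarz _ _).
by rewrite trmxK fro2E !big_ord1 /mxtrace big_ord1.
Qed.

Lemma vnormE n (v : 'cV[R]_n) : vnorm v = Num.sqrt (fro2 v).
Proof. by rewrite /vnorm fro2E big_ord1. Qed.

Lemma vnorm_ge0 n (v : 'cV[R]_n) : 0 <= vnorm v.
Proof. exact: sqrtr_ge0. Qed.

Lemma vnorm_sqr n (v : 'cV[R]_n) : vnorm v ^+ 2 = fro2 v.
Proof. by rewrite vnormE sqr_sqrtr // fro2_ge0. Qed.

Lemma vnorm_gt0 n (v : 'cV[R]_n) : v != 0 -> 0 < vnorm v.
Proof. by move=> v0; rewrite vnormE sqrtr_gt0 fro2_gt0. Qed.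

Lemma vnorm0 n : vnorm (0 : 'cV[R]_n) = 0.
Proof. by rewrite vnormE fro20 sqrtr0. Qed.

Lemma vnormZ n a (v : 'cV[R]_n) : vnorm (a *: v) = `|a| * vnorm v.
Proof. by rewrite !vnormE fro2Z sqrtrM ?sqr_ge0 // sqrtr_sqr. Qed.

Lemma vnormD n (v w : 'cV[R]_n) : vnorm (v + w) <= vnorm v + vnorm w.
Proof.
rewrite -ler_sqr ?nnegrE ?addr_ge0 ?vnorm_ge0 // sqrrD !vnorm_sqr fro2D.
have : \tr (v^T *m w) <= vnorm v * vnorm w.
  apply: le_trans (ler_norm _) _.
  rewrite -ler_sqr ?nnegrE ?mulr_ge0 ?vnorm_ge0 // real_normK ?num_real //.
  by rewrite exprMn !vnorm_sqr fro2_CauchySchwarz.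
by rewrite -mulr_natl; lra.
Qed.

End FrobeniusNorm.

(** * The operator norm and its comparison with the Frobenius norm *)

Section OperatorNorm.
Context {R : realType}.

Lemma vnorm_mulmx_le m n (M : 'M[R]_(m, n)) (x : 'cV[R]_n) :
  vnorm (M *m x) <= Num.sqrt (fro2 M) * vnorm x.
Proof. by rewrite !vnormE -sqrtrM ?fro2_ge0 // ler_wsqrtr // fro2M. Qed.

Let opnorm_set m n (M : 'M[R]_(m, n)) :=
  [set r | exists x : 'cV[R]_n, vnorm x <= 1 /\ r = vnorm (M *m x)].

Let opnorm_set_ub m n (M : 'M[R]_(m, n)) : has_ubound (opnorm_set M).
Proof.
exists (Num.sqrt (fro2 M)) => _ [x [x1 ->]].
by apply: le_trans (vnorm_mulmx_le _ _) _; rewrite ler_piMr // sqrtr_ge0.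
Qed.

Lemma opnorm_ge0 m n (M : 'M[R]_(m, n)) : 0 <= opnorm M.
Proof.
apply: (ub_le_sup (opnorm_set_ub M)); exists 0.
by rewrite mulmx0 !vnorm0.
Qed.

Lemma vnorm_mulmx m n (M : 'M[R]_(m, n)) (x : 'cV[R]_n) :
  vnorm (M *m x) <= opnorm M * vnorm x.
Proof.
have [->|x0] := eqVneq x 0; first by rewrite mulmx0 !vnorm0 mulr0.
have vx0 := vnorm_gt0 x0.
rewrite -ler_pdivrMr //; apply: (ub_le_sup (opnorm_set_ub M)).
exists ((vnorm x)^-1 *: x).
by rewrite -scalemxAr !vnormZ ger0_norm ?invr_ge0 ?vnorm_ge0 // mulVf ?gt_eqF // mulrC.
Qed.

Lemma opnorm_le m n (M : 'M[R]_(m, n)) c : 0 <= c ->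
  (forall x, vnorm (M *m x) <= c * vnorm x) -> opnorm M <= c.
Proof.
move=> c0 Mc; apply: ge_sup; first by exists (vnorm (M *m 0)), 0; rewrite vnorm0.
by move=> _ [x [x1 ->]]; apply: le_trans (Mc x) _; rewrite ler_piMr.
Qed.

Lemma opnormM m n k (X : 'M[R]_(m, n)) (Y : 'M[R]_(n, k)) :
  opnorm (X *m Y) <= opnorm X * opnorm Y.
Proof.
apply: opnorm_le => [|x]; first by rewrite mulr_ge0 // opnorm_ge0.
rewrite -mulmxA; apply: le_trans (vnorm_mulmx _ _) _.
by rewrite -mulrA ler_wpM2l ?opnorm_ge0 // vnorm_mulmx.
Qed.

Lemma opnormD m n (X Y : 'M[R]_(m, n)) : opnorm (X + Y) <= opnorm X + opnorm Y.
Proof.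
apply: opnorm_le => [|x]; first by rewrite addr_ge0 // opnorm_ge0.
by rewrite mulmxDl; apply: le_trans (vnormD _ _) _; rewrite mulrDl lerD ?vnorm_mulmx.
Qed.

Lemma opnormN m n (X : 'M[R]_(m, n)) : opnorm (- X) = opnorm X.
Proof.
congr (sup _); apply/seteqP; split => _ [x [x1 ->]]; exists x; split => //;
  by rewrite mulNmx !vnormE fro2N.
Qed.

Lemma opnorm_le_fro m n (M : 'M[R]_(m, n)) : opnorm M <= Num.sqrt (fro2 M).
Proof. by apply: opnorm_le (vnorm_mulmx_le M); exact: sqrtr_ge0. Qed.

(** Applied column by column. With [X] an isometry of [q] columns, this is how a factor [q] enters
    the final bounds. *)
Lemma fro2_mulmx m n k (M : 'M[R]_(m, n)) (X : 'M[R]_(n, k)) :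
  fro2 (M *m X) <= opnorm M ^+ 2 * fro2 X.
Proof.
rewrite !(fro2_cols (n := k)) mulr_sumr; apply: ler_sum => j _.
rewrite col_mulmx -!vnorm_sqr -exprMn ler_sqr ?nnegrE ?vnorm_ge0 ?vnorm_mulmx //.
by rewrite mulr_ge0 ?opnorm_ge0 ?vnorm_ge0.
Qed.

(** [|M^T y|^2 = <y, M M^T y> <= |y| |M| |M^T y|]; divide by [|M^T y|]. *)
Lemma opnorm_tr_le m n (M : 'M[R]_(m, n)) : opnorm M^T <= opnorm M.
Proof.
apply: opnorm_le => [|y]; first exact: opnorm_ge0.
have [->|My0] := eqVneq (M^T *m y) 0; first by rewrite vnorm0 mulr_ge0 ?opnorm_ge0 ?vnorm_ge0.
rewrite -(ler_pM2l (vnorm_gt0 My0)) -expr2 vnorm_sqr.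
have -> : fro2 (M^T *m y) = \tr (y^T *m (M *m (M^T *m y))).
  by rewrite /fro2 trmx_mul trmxK !mulmxA.
apply: le_trans (ler_norm _) _.
have := fro2_CauchySchwarz y (M *m (M^T *m y)).
rewrite -!vnorm_sqr -exprMn -real_normK ?num_real // ler_sqr ?nnegrE ?mulr_ge0 ?vnorm_ge0 //.
move=> /le_trans; apply.
by rewrite [leLHS]mulrC mulrA ler_wpM2r ?vnorm_ge0 // mulrC vnorm_mulmx.
Qed.

End OperatorNorm.

(** * Singular value decomposition *)

Section SingularValueDecomposition.
Context {R : realType}.

Lemma orthogonal_mx1 n : orthogonal_mx (1%:M : 'M[R]_n).
Proof. by rewrite /orthogonal_mx trmx1 mulmx1. Qed.

Lemma orthogonal_mxM n (P Q : 'M[R]_n) :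
  orthogonal_mx P -> orthogonal_mx Q -> orthogonal_mx (P *m Q).
Proof.
by move=> PP QQ; rewrite /orthogonal_mx trmx_mul mulmxA -(mulmxA Q^T) PP mulmx1.
Qed.

Lemma orthogonal_mx_tr n (Q : 'M[R]_n) : orthogonal_mx Q -> Q *m Q^T = 1%:M.
Proof. exact: mulmx1C. Qed.

Lemma orthogonal_mxT n (Q : 'M[R]_n) : orthogonal_mx Q -> orthogonal_mx Q^T.
Proof. by move=> QQ; rewrite /orthogonal_mx trmxK orthogonal_mx_tr. Qed.

Lemma orthogonal_block_mx m n (P : 'M[R]_m) (Q : 'M[R]_n) :
  orthogonal_mx P -> orthogonal_mx Q -> orthogonal_mx (block_mx P 0 0 Q).
Proof.
move=> PP QQ; rewrite /orthogonal_mx tr_block_mx mulmx_block.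
by rewrite !trmx0 !mul0mx !mulmx0 !addr0 add0r PP QQ -scalar_mx_block.
Qed.

(* The Householder reflection exchanging [e_0] and [x]. *)
Lemma orthogonal_mx_first_col n (x : 'cV[R]_n.+1) : fro2 x = 1 ->
  exists2 Q : 'M[R]_n.+1, orthogonal_mx Q & Q *m delta_mx 0 0 = x.
Proof.
move=> x1; pose d : 'cV[R]_n.+1 := delta_mx 0 0; pose v := d - x.
have [v0|v0] := eqVneq v 0.
  exists 1%:M; first exact: orthogonal_mx1.
  by rewrite mul1mx; apply/eqP; rewrite -subr_eq0; apply/eqP.
have dd : d^T *m d = 1%:M.
  by rewrite trmx_delta mul_delta_mx; apply/matrixP => i j; rewrite !ord1 !mxE.
have tr1 (M : 'M[R]_1) : M = (\tr M)%:M by rewrite [LHS]mx11_scalar /mxtrace big_ord1.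
pose a := fro2 v.
have a0 : a != 0 by rewrite /a fro2_eq0.
have vv : v^T *m v = a%:M by rewrite [LHS]tr1.
(* Both [d] and [x] are unit vectors, so [|v|^2 = 2 - 2 <x, d>]. Hence the reflection [Q] sends [d]
   to [d - v = x]. *)
have vd : v^T *m d = (a / 2)%:M.
  rewrite [LHS]tr1; congr (_%:M).
  have -> : a = 2 - 2 * \tr (x^T *m d).
    by rewrite /a fro2B x1 {1}/fro2 dd mxtrace1 mxtrace_tr_mulC; ring.
  rewrite [v^T]linearB /= mulmxBl linearB /= dd mxtrace1; by field.
pose Q := 1%:M - (2 / a) *: (v *m v^T).
have QT : Q^T = Q.
  by rewrite /Q [LHS]linearB /= trmx1 [(_ *: _)^T]linearZ /= trmx_mul trmxK.
exists Q; last first.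
  rewrite /Q mulmxBl mul1mx -scalemxAl -mulmxA vd mul_mx_scalar scalerA.
  have -> : 2 / a * (a / 2) = 1 by field.
  by rewrite scale1r subKr.
have vvE : v *m v^T *m (v *m v^T) = a *: (v *m v^T).
  by rewrite mulmxA -(mulmxA v) vv mul_mx_scalar -scalemxAl.
rewrite /orthogonal_mx QT /Q mulmxBl !mulmxBr !mulmx1 mul1mx.
rewrite -scalemxAl -scalemxAr vvE !scalerA.
have -> : 2 / a * (2 / a) * a = 2 / a + 2 / a by field.
by rewrite scalerDl opprB addrK subrK.
Qed.

Lemma fro2_mulmx_continuous m n (M : 'M[R]_(m, n)) :
  continuous (fun x : 'rV[R]_n => fro2 (M *m x^T)).
Proof.
have -> : (fun x : 'rV[R]_n => fro2 (M *m x^T)) =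
    (fun x => \sum_i (\sum_j M i j * x 0 j) * (\sum_j M i j * x 0 j)).
  apply/funext => x; rewrite fro2E big_ord1; apply: eq_bigr => i _.
  by rewrite mxE expr2; congr (_ * _); apply: eq_bigr => j _; rewrite mxE.
have csum k (F : 'I_k -> 'rV[R]_n -> R) : (forall i, continuous (F i)) ->
    continuous (fun x => \sum_i F i x).
  by move=> cF; apply: continuous_big => //; exact: add_continuous.
have cl i : continuous (fun x : 'rV[R]_n => \sum_j M i j * x 0 j).
  by apply: csum => j x; apply: (@continuousM _ _ (cst (M i j)));
    [exact: cst_continuous|exact: coord_continuous].
by apply: csum => i x; apply: continuousM; exact: cl.
Qed.

(** The continuous map [fro2 (M *m _)] attains its maximum on the compact unit sphere; homogeneity
    extends the bound to all vectors. Row vectors carry the topological part, as [rV_compact] and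
    [EVT_max_rV] concern them. *)
Lemma sphere_max m n (M : 'M[R]_(m, n.+1)) :
  exists2 x : 'cV[R]_n.+1, fro2 x = 1 &
    forall y : 'cV[R]_n.+1, fro2 (M *m y) <= fro2 (M *m x) * fro2 y.
Proof.
pose A := [set x : 'rV[R]_n.+1 | fro2 x = 1].
have sz (x : 'rV[R]_n.+1) : fro2 ((1%:M : 'M[R]_n.+1) *m x^T) = fro2 x by rewrite mul1mx fro2_tr.
have A0 : A !=set0.
  exists (delta_mx 0 0); rewrite /A /= /fro2 trmx_delta mul_delta_mx.
  rewrite /mxtrace (bigD1 0) //= big1 => [|i /negbTE i0]; last by rewrite mxE i0.
  by rewrite mxE addr0.
(* The sphere is a closed subset of the cube with sides [[-1, 1]]. *)
have cA : compact A.
  apply: (@subclosed_compact _ _ [set v : 'rV[R]_n.+1 | forall i, `[(-1), 1]%classic (v ord0 i)]).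
  - have -> : A = (fun x : 'rV[R]_n.+1 => fro2 (1%:M *m x^T)) @^-1` [set (1:R)].
      by apply/seteqP; split => x /=; rewrite sz.
    apply: preimage_closed; last exact: closed_eq.
    by move=> x _; exact: fro2_mulmx_continuous.
  - by apply: (@rV_compact R _ (fun=> `[(-1) : R, 1 : R]%classic)) => _; exact: segment_compact.
  - move=> v /= v1 i; rewrite in_itv /= -ler_norml.
    rewrite -(@expr_le1 _ 2) // real_normK ?num_real // -v1 fro2E.
    rewrite (bigD1 i) //= big_ord1 lerDl.
    by do 2! apply: sumr_ge0 => ? _; exact: sqr_ge0.
have [x /set_mem xA xmax] := EVT_max_rV A0 cA (continuous_subspaceT (@fro2_mulmx_continuous _ _ M)).
exists x^T; first by rewrite fro2_tr.
move=> y; have [->|y0] := eqVneq y 0; first by rewrite mulmx0 !fro20 mulr0.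
have vy0 : 0 < vnorm y by exact: vnorm_gt0.
have /xmax : (vnorm y)^-1 *: y^T \in A.
  by apply/mem_set; rewrite /A /= fro2Z fro2_tr -vnorm_sqr -exprMn mulVf ?gt_eqF // expr1n.
rewrite linearZ /= trmxK -scalemxAr fro2Z -vnorm_sqr exprVn.
by rewrite mulrC ler_pdivrMr ?exprn_gt0 // vnorm_sqr vnorm_sqr.
Qed.

(** * Truncation to leading singular vectors, and the Courant-Fischer bounds *)

Lemma firstcols_mxE m n q (M : 'M[R]_(m, n)) : (q <= n)%N ->
  firstcols_mx q M = M *m pid_mx q.
Proof.
move=> qn; apply/matrixP => i j; rewrite !mxE /mx_at insubT //= => im.
rewrite insubT ?(leq_trans (ltn_ord j)) //= => jn.
rewrite (bigD1 (Ordinal jn)) //= big1 => [|k kj]; rewrite !mxE /=.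
  by rewrite eqxx ltn_ord mulr1 addr0; congr (M _ _); apply: val_inj.
by rewrite (_ : (k == j :> nat) = false) ?mulr0 //; apply: contraNF kj.
Qed.

Lemma firstcols_mx_isom n q (V : 'M[R]_n) : (q <= n)%N -> orthogonal_mx V ->
  (firstcols_mx q V)^T *m firstcols_mx q V = 1%:M.
Proof.
move=> qn VV; rewrite firstcols_mxE // trmx_mul mulmxA -(mulmxA _ V^T) VV mulmx1.
by rewrite tr_pid_mx mul_pid_mx minnn (minn_idPr qn) pid_mx_1.
Qed.

Lemma rdiag_mx_pid m n q (s : nat -> R) : (q <= minn m n)%N ->
  rdiag_mx m n s *m pid_mx q = pid_mx q *m sqdiag_mx q s.
Proof.
rewrite leq_min => /andP[qm qn]; apply/matrixP => i j; rewrite !mxE.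
have jn := leq_trans (ltn_ord j) qn.
rewrite (bigD1 (Ordinal jn)) //= big1 => [|k kj]; rewrite !mxE /=; last first.
  by rewrite (_ : (k == j :> nat) = false) ?mulr0 //; apply: contraNF kj.
rewrite (bigD1 j) //= big1 => [|k kj]; rewrite !mxE /=; last by rewrite (negbTE kj) mulr0.
rewrite !eqxx ltn_ord mulr1 !addr0; case: eqP => [->|]; last by rewrite mul0r.
by rewrite ltn_ord mul1r.
Qed.

Lemma svd_nonincr m n (M : 'M[R]_(m, n)) U s V i k : is_svd M U s V ->
  (i <= k)%N -> s k <= s i.
Proof.
move=> [_ _ s_mono _ _] /subnK <-; elim: (k - i)%N => [//|j].
by apply: le_trans; case: (s_mono (j + i)%N).
Qed.

Lemma svd_firstcols m n (M : 'M[R]_(m, n)) U s V q : is_svd M U s V ->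
  (q <= minn m n)%N -> M *m firstcols_mx q V = firstcols_mx q U *m sqdiag_mx q s.
Proof.
case=> _ VV _ _ -> qmn; have := qmn; rewrite leq_min => /andP[qm qn].
by rewrite !firstcols_mxE // mulmxA -(mulmxA _ V^T) VV mulmx1 -!mulmxA rdiag_mx_pid.
Qed.

Lemma sqdiag_mxE q k (s : nat -> R) (X : 'M[R]_(q, k)) i j :
  (sqdiag_mx q s *m X) i j = s i * X i j.
Proof.
rewrite mxE (bigD1 i) //= big1 => [|l li]; rewrite !mxE ?eqxx ?addr0 //.
by rewrite eq_sym (negbTE li) mul0r.
Qed.

Lemma ker_mx_ex r q (F : 'M[R]_(r, q)) : (r < q)%N ->
  exists2 z : 'cV[R]_q, z != 0 & F *m z = 0.
Proof.
move=> rq; have /rowV0Pn[v /sub_kermxP vF v0] : kermx F^T != 0.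
  rewrite -mxrank_eq0 mxrank_ker -lt0n subn_gt0.
  by rewrite (leq_ltn_trans (rank_leq_col _)).
exists v^T; first by rewrite -trmx0 (inj_eq (@trmx_inj _ _ _)).
by rewrite -(trmxK F) -trmx_mul vF trmx0.
Qed.

(* Courant-Fischer: [r <= k] linear constraints cannot exclude the span of the
   first [k + 1] right singular vectors. *)
Lemma svd_constrained m n r (M : 'M[R]_(m, n)) U s V k (F : 'M[R]_(r, n)) :
  is_svd M U s V -> (r <= k < minn m n)%N ->
  exists x : 'cV[R]_n, [/\ x != 0, F *m x = 0 & s k * vnorm x <= vnorm (M *m x)].
Proof.
move=> svdM /andP[rk kmn].
have := kmn; rewrite leq_min => /andP[km kn].
have [z z0 Fz] := ker_mx_ex (F *m firstcols_mx k.+1 V) rk.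
case: (svdM) => UU VV s_mono _ _.
have Vz : fro2 (firstcols_mx k.+1 V *m z) = fro2 z.
  by rewrite fro2_isom // firstcols_mx_isom.
have sk0 : 0 <= s k by case: (s_mono k).
exists (firstcols_mx k.+1 V *m z); split; last 1 first.
- rewrite mulmxA (svd_firstcols svdM) // -mulmxA !vnormE Vz.
  rewrite [X in _ <= Num.sqrt X]fro2_isom ?firstcols_mx_isom //.
  rewrite -[leLHS](ger0_norm _) ?mulr_ge0 ?sqrtr_ge0 // -sqrtr_sqr.
  apply: ler_wsqrtr; rewrite exprMn sqr_sqrtr ?fro2_ge0 // !fro2E !big_ord1 mulr_sumr.
  apply: ler_sum => i _; rewrite sqdiag_mxE exprMn ler_wpM2r ?sqr_ge0 //.
  have ski : s k <= s i by apply: (svd_nonincr svdM); rewrite -ltnS.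
  by rewrite ler_sqr ?nnegrE // (le_trans sk0).
- by rewrite -fro2_eq0 Vz fro2_eq0.
- by rewrite mulmxA.
Qed.

Lemma rdiag_mx_fro2_le m n (t : nat -> R) c (y : 'cV[R]_n) :
  (forall k, t k ^+ 2 <= c ^+ 2) -> fro2 (rdiag_mx m n t *m y) <= c ^+ 2 * fro2 y.
Proof.
move=> tc; rewrite !fro2E !big_ord1.
pose D := rdiag_mx m n t.
have c20 := sqr_ge0 c.
(* A row of [D] has at most one nonzero entry, so the square of its sum is the sum of squares. The
   same sparsity of the columns is used after exchanging the sums. *)
apply: (@le_trans _ _ (\sum_i \sum_j D i j ^+ 2 * y j 0 ^+ 2)).
  apply: ler_sum => i _; rewrite mxE.
  have [i_n|n_i] := ltnP i n.
    rewrite (bigD1 (Ordinal i_n)) //= big1 ?addr0 => [|j ji]; last first.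
      rewrite mxE (_ : (i == j :> nat) = false) ?mul0r //.
      by apply: contraNF ji => /eqP ij; apply/eqP/val_inj.
    rewrite (bigD1 (Ordinal i_n)) //= exprMn lerDl.
    by apply: sumr_ge0 => j _; rewrite -exprMn sqr_ge0.
  rewrite big1 ?expr0n => [|j _]; last first.
    by rewrite mxE gtn_eqF ?mul0r // (leq_trans (ltn_ord j)).
  by apply: sumr_ge0 => j _; rewrite -exprMn sqr_ge0.
rewrite exchange_big mulr_sumr; apply: ler_sum => j _.
rewrite -mulr_suml ler_wpM2r ?sqr_ge0 //.
have [jm|mj] := ltnP j m.
  rewrite (bigD1 (Ordinal jm)) //= big1 => [|i ij]; rewrite !mxE /= ?eqxx ?addr0 //.
  rewrite (_ : (i == j :> nat) = false) ?expr0n //.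
  by apply: contraNF ij.
rewrite big1 // => i _; rewrite mxE ltn_eqF ?expr0n //.
by rewrite (leq_trans (ltn_ord i)).
Qed.

(** In singular coordinates the projection zeroes the first [q] diagonal entries. Since [s] is
    indexed from 0, the largest one left is [s q], the [q+1]-st singular value. *)
Lemma svd_tail m n (M : 'M[R]_(m, n)) U s V q : is_svd M U s V ->
  (q <= n)%N ->
  opnorm (M *m (1%:M - firstcols_mx q V *m (firstcols_mx q V)^T)) <= s q.
Proof.
move=> svdM; case: (svdM) => UU VV s_mono _ -> qn.
have sq0 : 0 <= s q by case: (s_mono q).
pose t k := if (k < q)%N then 0 else s k.
have -> : U *m rdiag_mx m n s *m V^T *m
    (1%:M - firstcols_mx q V *m (firstcols_mx q V)^T) = U *m rdiag_mx m n t *m V^T.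
  rewrite firstcols_mxE // trmx_mul tr_pid_mx mulmxA -(mulmxA V) mul_pid_mx.
  have -> : 1%:M - V *m pid_mx (minn q (minn q q)) *m V^T = V *m (1%:M - pid_mx q) *m V^T.
    by rewrite !minnn mulmxBr mulmxBl mulmx1 orthogonal_mx_tr.
  rewrite !mulmxA -(mulmxA _ V^T) VV mulmx1; congr (_ *m _).
  rewrite -mulmxA; congr (_ *m _); apply/matrixP => i j; rewrite !mxE.
  rewrite (bigD1 j) //= big1 => [|k kj].
    rewrite !mxE !eqxx addr0 /t; case: eqP => [->|]; last by rewrite mul0r.
    by case: ltnP; rewrite ?subrr ?subr0 ?mulr0 ?mulr1.
  by rewrite !mxE (negbTE kj) (_ : (k == j :> nat) = false) ?subrr ?mulr0 //; apply: contraNF kj.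
apply: opnorm_le => // x.
rewrite -ler_sqr ?nnegrE ?mulr_ge0 ?vnorm_ge0 // exprMn !vnorm_sqr -!mulmxA fro2_isom //.
rewrite -[fro2 x](@fro2_isom _ _ _ _ V^T); last by rewrite trmxK orthogonal_mx_tr.
apply: rdiag_mx_fro2_le => k; rewrite /t; case: ltnP => qk.
  by rewrite expr0n sqr_ge0.
rewrite ler_sqr ?nnegrE //; last by case: (s_mono k).
exact: (svd_nonincr svdM).
Qed.

(** * Existence of the singular value decomposition by deflation *)

Lemma rdiag_mx_block m n c (s : nat -> R) :
  rdiag_mx (1 + m) (1 + n) (fun k => if k is k'.+1 then s k' else c) =
  block_mx c%:M 0 0 (rdiag_mx m n s).
Proof.
apply/matrixP => i j; rewrite !mxE.
case: splitP => i' i'E; rewrite mxE; case: splitP => j' j'E; rewrite !mxE i'E j'E;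
  by rewrite ?ord1 ?mulr1n ?mulr0n //=.
Qed.

(* If [c] is the norm of [block_mx c w 0 M'], then testing on [(c, w)] forces [w = 0]. *)
Lemma block_mx_extremal m n c (w : 'rV[R]_n) (M : 'M[R]_(m, n)) :
  (forall z : 'cV[R]_(1 + n), fro2 (block_mx c%:M w 0 M *m z) <= c ^+ 2 * fro2 z) -> w = 0.
Proof.
move=> /(_ (col_mx c%:M w^T)); rewrite mul_block_col fro2_col_mx fro2_col_mx fro2_tr.
have -> : c%:M *m c%:M + w *m w^T = (c ^+ 2 + fro2 w)%:M.
  rewrite -scalar_mxM raddfD /= -expr2; congr (_ + _).
  by rewrite [LHS]mx11_scalar -fro2_tr /fro2 trmxK /mxtrace big_ord1.
have fc (a : R) : fro2 (a%:M : 'M[R]_1) = a ^+ 2 by rewrite fro2E !big_ord1 mxE eqxx mulr1n.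
rewrite !fc => le1; apply/eqP; rewrite -fro2_eq0; apply/negPn/negP => w0.
have : 0 < fro2 w by rewrite lt_def w0 fro2_ge0.
have := fro2_ge0 (0 *m c%:M + M *m w^T); have := sqr_ge0 c.
(* With [a = c^2] and [b = |w|^2], the hypothesis reads [(a + b)^2 + e <= a (a + b)], impossible for
   [b > 0] and [a, e >= 0]. *)
move: le1; move: (c ^+ 2) (fro2 w) (fro2 (_ + _)) => a b e; nra.
Qed.

Lemma first_col_block m n c (N : 'M[R]_(1 + m, 1 + n)) :
  N *m delta_mx 0 0 = c *: (delta_mx 0 0 : 'cV[R]_(1 + m)) ->
  N = block_mx c%:M (ursubmx N) 0 (drsubmx N).
Proof.
rewrite -colE => Ne.
rewrite -[LHS]submxK; congr block_mx; apply/matrixP => i j; rewrite !ord1 !mxE.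
  have /matrixP/(_ (lshift _ 0) 0) := Ne; rewrite !mxE !eqxx mulr1 mulr1n => <-.
  by congr (N _ _); apply: val_inj.
have /matrixP/(_ (rshift 1 i) 0) := Ne; rewrite !mxE /= mulr0 => <-.
by congr (N _ _); apply: val_inj.
Qed.

(** The inductive step for [svd_exists]; the condition [s 0 <= c] keeps the extended sequence
    nonincreasing. *)
Lemma svd_block m n c (M : 'M[R]_(m, n)) U s V (P : 'M[R]_(1 + m)) (Q : 'M[R]_(1 + n)) :
  orthogonal_mx P -> orthogonal_mx Q -> s 0%N <= c -> is_svd M U s V ->
  is_svd (P *m block_mx c%:M 0 0 M *m Q^T) (P *m block_mx 1%:M 0 0 U)
    (fun k => if k is k'.+1 then s k' else c) (Q *m block_mx 1%:M 0 0 V).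
Proof.
move=> PO QO sc [UU VV s_mono s_end ->].
have c0 : 0 <= c by apply: le_trans sc; case: (s_mono 0%N).
split.
- exact: orthogonal_mxM (orthogonal_block_mx (orthogonal_mx1 1) UU).
- exact: orthogonal_mxM (orthogonal_block_mx (orthogonal_mx1 1) VV).
- by case=> [|k]; [split|exact: s_mono].
- by case=> [|k]; rewrite minnSS // ltnS; exact: s_end.
rewrite rdiag_mx_block trmx_mul tr_block_mx !trmx0 trmx1.
rewrite !mulmxA; congr (_ *m _); rewrite -!mulmxA; congr (_ *m _).
by rewrite !mulmx_block !(mulmx0, mul0mx, addr0, add0r, mul1mx, mulmx1) mulmxA.
Qed.

(** Induction on the number of rows. Let [x] be a unit vector maximising [|M x| = c] and write
    [M x = c y]. Reflections sending the first basis vector to [x] and [y] turn [M] into a matrix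
    with first column [(c, 0)]; extremality clears the rest of the first row, and the remaining
    block is decomposed recursively. *)
Lemma svd_exists m n (M : 'M[R]_(m, n)) : exists U s V, is_svd M U s V.
Proof.
elim: m n M => [|m IHm] n M.
  exists 1%:M, (fun=> 0), 1%:M; split;
    [exact: orthogonal_mx1|exact: orthogonal_mx1|by move=> k; rewrite lexx|by []|].
  by rewrite [LHS]flatmx0 [RHS]flatmx0.
case: n M => [|n] M.
  exists 1%:M, (fun=> 0), 1%:M; split;
    [exact: orthogonal_mx1|exact: orthogonal_mx1|by move=> k; rewrite lexx|by []|].
  by apply: trmx_inj; rewrite [LHS]flatmx0 [RHS]flatmx0.
have [x x1 xmax] := sphere_max M.
pose c := vnorm (M *m x).
have c0 : 0 <= c by exact: vnorm_ge0.
have [y y1 Mx] : exists2 y : 'cV[R]_m.+1, fro2 y = 1 & M *m x = c *: y.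
  have [Mx0|Mx0] := eqVneq (M *m x) 0.
    exists (delta_mx 0 0); last by rewrite /c Mx0 vnorm0 scale0r.
    rewrite /fro2 trmx_delta mul_delta_mx /mxtrace big_ord1 mxE eqxx //.
  have cn0 : c != 0 by rewrite gt_eqF // vnorm_gt0.
  exists (c^-1 *: (M *m x)); last by rewrite scalerA divff // scale1r.
  by rewrite fro2Z -vnorm_sqr -exprMn mulVf // expr1n.
have [Hu HuO Hue] := orthogonal_mx_first_col y1.
have [Hv HvO Hve] := orthogonal_mx_first_col x1.
pose N : 'M[R]_(1 + m, 1 + n) := Hu^T *m M *m Hv.
have Nmax (z : 'cV[R]_(1 + n)) : fro2 (N *m z) <= c ^+ 2 * fro2 z.
  rewrite /N -!mulmxA fro2_isom ?trmxK ?orthogonal_mx_tr // /c vnorm_sqr.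
  by rewrite -[fro2 z](fro2_isom _ HvO).
have Ne : N *m delta_mx 0 0 = c *: (delta_mx 0 0 : 'cV[R]_(1 + m)).
  by rewrite /N -!mulmxA Hve Mx -scalemxAr -Hue mulmxA HuO mul1mx.
have NE := first_col_block Ne.
have w0 : ursubmx N = 0.
  by apply: (@block_mx_extremal m n c _ (drsubmx N)) => z; move: (Nmax z); rewrite {1}NE.
rewrite w0 in NE; have [U [s [V svdN]]] := IHm _ (drsubmx N).
(* [svd_constrained] with no constraint gives [z] stretched by at least [s 0]; padding it with a
   leading 0 yields a test vector for the maximality of [c]. For an empty block, [s 0 = 0] by
   [is_svd]. *)
have s0 : s 0%N <= c.
  have [mn0|mn0] := leqP (minn m n) 0.
    by case: svdN => _ _ _ /(_ _ mn0) ->.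
  have [z [z0 _ /le_trans zs]] := svd_constrained (0 : 'M[R]_(0, n)) svdN mn0.
  rewrite -(ler_pM2r (vnorm_gt0 z0)); apply: zs.
  rewrite -ler_sqr ?nnegrE ?mulr_ge0 ?vnorm_ge0 // exprMn !vnorm_sqr.
  have := Nmax (col_mx 0 z); rewrite {1}NE mul_block_col !mul0mx mulmx0 !add0r.
  by rewrite !fro2_col_mx !fro20 !add0r /c vnorm_sqr.
have -> : M = Hu *m N *m Hv^T.
  by rewrite /N !mulmxA orthogonal_mx_tr // mul1mx -mulmxA orthogonal_mx_tr // mulmx1.
by rewrite NE; do 3! eexists; exact: (svd_block HuO HvO s0 svdN).
Qed.

(** [singval] is a choice among values read off decompositions; by [svd_exists] the default 0 of
    [xget] is never taken by default, so a witnessing decomposition is available. *)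
Lemma singval_svd m n (M : 'M[R]_(m, n)) k :
  exists U s V, is_svd M U s V /\ singval M k = s k.-1.
Proof.
rewrite /singval; case: xgetP => [r _ [U [s [V [svdM <-]]]]|noM].
  by exists U, s, V.
have [U [s [V svdM]]] := svd_exists M.
by case: (noM (s k.-1)); exists U, s, V.
Qed.

End SingularValueDecomposition.

(** * Perturbation of balanced factors *)

Section Procrustes.
Context {R : realType}.

Lemma sqdiag_mxM q (s t : nat -> R) :
  sqdiag_mx q s *m sqdiag_mx q t = sqdiag_mx q (fun k => s k * t k).
Proof.
apply/matrixP => i j; rewrite sqdiag_mxE !mxE.
by case: eqP => // _; rewrite mulr0.
Qed.

Lemma tr_sqdiag_mx q (s : nat -> R) : (sqdiag_mx q s)^T = sqdiag_mx q s.
Proof. by apply/matrixP => i j; rewrite !mxE eq_sym; case: eqP => // ->. Qed.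

Lemma sqdiag_mx_sqrt q (s : nat -> R) : (forall k, (k < q)%N -> 0 <= s k) ->
  sqdiag_mx q (fun k => Num.sqrt (s k)) *m sqdiag_mx q (fun k => Num.sqrt (s k)) =
  sqdiag_mx q s.
Proof.
move=> s0; rewrite sqdiag_mxM; apply/matrixP => i j; rewrite !mxE.
by case: eqP => // _; rewrite -expr2 sqr_sqrtr // s0.
Qed.

Lemma mxtrace_sqdiag m q (s : nat -> R) (X Y : 'M[R]_(m, q)) :
  \tr (X *m sqdiag_mx q s *m Y^T) = \sum_(j < q) s j * \sum_i X i j * Y i j.
Proof.
rewrite -mulmxA mxtrace_mulC -mulmxA; apply: eq_bigr => j _.
rewrite sqdiag_mxE mxE; congr (_ * _); apply: eq_bigr => i _.
by rewrite mxE mulrC.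
Qed.

Lemma mxtrace_sqdiag_ge m q c (s : nat -> R) (X : 'M[R]_(m, q)) :
  (forall k, (k < q)%N -> c <= s k) ->
  c * fro2 X <= \tr (X *m sqdiag_mx q s *m X^T).
Proof.
move=> cs; rewrite mxtrace_sqdiag fro2E mulr_sumr; apply: ler_sum => j _.
under [in leRHS]eq_bigr do rewrite -expr2.
by rewrite ler_wpM2r ?cs // sumr_ge0 // => i _; rewrite sqr_ge0.
Qed.

(** Polar decomposition: for [G = U diag(s) V^T], the orthogonal factor is [T = U V^T]. *)
Lemma polar_exists q (G : 'M[R]_q) : exists T V s,
  [/\ orthogonal_mx T, orthogonal_mx V, forall k, 0 <= s k &
      T^T *m G = V *m sqdiag_mx q s *m V^T].
Proof.
have [U [s [V [UU VV s_mono _ ->]]]] := svd_exists G.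
exists (U *m V^T), V, s; split => //.
- by apply: orthogonal_mxM => //; exact: orthogonal_mxT.
- by move=> k; case: (s_mono k).
rewrite trmx_mul trmxK !mulmxA -(mulmxA V) UU mulmx1; congr (_ *m _ *m _).
Qed.

Lemma mxtrace_outer_mul m q (X Y X' Y' : 'M[R]_(m, q)) :
  \tr (X *m Y^T *m (X' *m Y'^T)) = \tr ((Y'^T *m X) *m (Y^T *m X')).
Proof. by rewrite mulmxA mxtrace_mulC !mulmxA. Qed.

(** Symmetry of [Z^T D] merges the mixed terms, and cyclicity of the trace brings all of them down
    to [q]-by-[q] matrices. *)
Lemma fro2_gram_increment m q (Z D : 'M[R]_(m, q)) : D^T *m Z = Z^T *m D ->
  fro2 ((Z + D) *m (Z + D)^T - Z *m Z^T) =
  2 * \tr (D^T *m D *m (Z^T *m Z)) + 2 * fro2 (Z^T *m D)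
  + 4 * \tr (D^T *m D *m (Z^T *m D)) + fro2 (D^T *m D).
Proof.
move=> ZD.
have -> : (Z + D) *m (Z + D)^T - Z *m Z^T = D *m Z^T + Z *m D^T + D *m D^T.
  rewrite [(Z + D)^T]linearD /= mulmxDl !mulmxDr -!addrA addrC !addrA subrK.
  by rewrite -!addrA addrCA.
rewrite /fro2 [(_ + D *m D^T)^T]linearD /= [(D *m Z^T + _)^T]linearD /= !trmx_mul !trmxK.
rewrite !(mulmxDl, mulmxDr) !mxtraceD !mxtrace_outer_mul ZD.
rewrite (mxtrace_mulC (Z^T *m Z)) (mxtrace_mulC (Z^T *m D) (D^T *m D)).
by ring.
Qed.

(** Let [T] be the polar factor of [Z^T Zh], [b = Z T], [A = D^T D], [B = b^T D] and [W = b^T b].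
    Then [B = S - W] with [S] positive semidefinite, and the right-hand side is
    [2 tr(A W) + 2 |B|^2 + 4 tr(A B) + |A|^2]. Subtracting [|A + (4/3) B|^2 >= 0] leaves at least
    [(2/3) tr(A W)], which dominates [(2/3) c |D|^2]. *)
Lemma procrustes m q (Z Zh : 'M[R]_(m, q)) l c :
  Z^T *m Z = sqdiag_mx q l -> (forall k, (k < q)%N -> c <= l k) ->
  exists2 T : 'M[R]_q, orthogonal_mx T &
    2 / 3 * c * fro2 (Zh - Z *m T) <= fro2 (Zh *m Zh^T - Z *m Z^T).
Proof.
move=> ZZ cl; have [T [V [s [TT VV s0 TG]]]] := polar_exists (Z^T *m Zh).
exists T => //; set D := Zh - Z *m T; pose b := Z *m T.
have bZh : b^T *m Zh = V *m sqdiag_mx q s *m V^T by rewrite -TG /b trmx_mul mulmxA.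
have bD : b^T *m D = V *m sqdiag_mx q s *m V^T - b^T *m b by rewrite mulmxBr bZh.
have Db : D^T *m b = b^T *m D.
  rewrite -[D^T *m b]trmxK trmx_mul trmxK bD [LHS]linearB /= !trmx_mul !trmxK.
  by rewrite tr_sqdiag_mx mulmxA.
have -> : Z *m Z^T = b *m b^T.
  by rewrite /b trmx_mul mulmxA -(mulmxA Z) orthogonal_mx_tr // mulmx1.
have -> : Zh = b + D by rewrite /D addrC subrK.
rewrite fro2_gram_increment //.
have AS : 0 <= \tr (D^T *m D *m (V *m sqdiag_mx q s *m V^T)).
  rewrite -mulmxA mxtrace_mulC !mulmxA -!mulmxA -trmx_mul !mulmxA.
  by rewrite -[leLHS](mul0r (fro2 (D *m V))) mxtrace_sqdiag_ge.
have AW : c * fro2 D <= \tr (D^T *m D *m (b^T *m b)).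
  rewrite -mulmxA mxtrace_mulC /b trmx_mul !mulmxA -(mulmxA _ Z^T) ZZ.
  rewrite -(mulmxA _ T) -{2}(trmxK T) -trmx_mul.
  rewrite -[fro2 D](@fro2_isomr _ _ _ _ T) //.
  by apply: mxtrace_sqdiag_ge.
have AB : \tr (D^T *m D *m (b^T *m D)) =
    \tr (D^T *m D *m (V *m sqdiag_mx q s *m V^T)) - \tr (D^T *m D *m (b^T *m b)).
  by rewrite bD mulmxBr linearB.
(* Any factor in ]1, sqrt 2] in place of 4/3 would do. *)
have sq : 0 <= fro2 (D^T *m D + (4 / 3) *: (b^T *m D)) by exact: fro2_ge0.
move: sq; rewrite fro2D fro2Z -scalemxAr mxtraceZ [(D^T *m D)^T]trmx_mul trmxK.
have := fro2_ge0 (b^T *m D).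
move: AB AS AW; move: (\tr _) (\tr _) (\tr _) (fro2 _) (fro2 _) (fro2 _) => *.
lra.
Qed.

(** Stacking the left and right factors forces one rotation to align both at once. *)
Definition balanced m n q (U : 'M[R]_(m, q)) (l : nat -> R) (V : 'M[R]_(n, q)) :=
  col_mx (U *m sqdiag_mx q (fun k => Num.sqrt (l k)))
         (V *m sqdiag_mx q (fun k => Num.sqrt (l k))).

Lemma balanced_gram m n q (U : 'M[R]_(m, q)) l (V : 'M[R]_(n, q)) :
  U^T *m U = 1%:M -> V^T *m V = 1%:M -> (forall k, (k < q)%N -> 0 <= l k) ->
  (balanced U l V)^T *m balanced U l V = sqdiag_mx q (fun k => 2 * l k).
Proof.
move=> UU VV l0; rewrite tr_col_mx mul_row_col !trmx_mul !tr_sqdiag_mx !mulmxA.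
rewrite -(mulmxA _ U^T) -(mulmxA _ V^T) UU VV !mulmx1 !sqdiag_mx_sqrt //.
by apply/matrixP => i j; rewrite !mxE; case: eqP; rewrite ?addr0 // mulrDl !mul1r.
Qed.

(** The off-diagonal blocks are the factored matrix and its transpose; [balanced_outer_dist]
    controls the diagonal ones by these. *)
Lemma balanced_outer m n q (U : 'M[R]_(m, q)) l (V : 'M[R]_(n, q)) :
  (forall k, (k < q)%N -> 0 <= l k) ->
  balanced U l V *m (balanced U l V)^T =
  block_mx (U *m sqdiag_mx q l *m U^T) (U *m sqdiag_mx q l *m V^T)
           (V *m sqdiag_mx q l *m U^T) (V *m sqdiag_mx q l *m V^T).
Proof.
move=> l0; rewrite tr_col_mx mul_col_row !trmx_mul !tr_sqdiag_mx !mulmxA.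
by rewrite -!(mulmxA _ (sqdiag_mx _ _) (sqdiag_mx _ _)) sqdiag_mx_sqrt.
Qed.

Lemma fro2_block_mx m1 m2 n1 n2 (A : 'M[R]_(m1, n1)) (B : 'M[R]_(m1, n2))
    (C : 'M[R]_(m2, n1)) (D : 'M[R]_(m2, n2)) :
  fro2 (block_mx A B C D) = fro2 A + fro2 B + fro2 C + fro2 D.
Proof. by rewrite /block_mx fro2_col_mx !fro2_row_mx addrA. Qed.

Lemma fro2_svd m n q (U : 'M[R]_(m, q)) l (V : 'M[R]_(n, q)) :
  U^T *m U = 1%:M -> V^T *m V = 1%:M ->
  fro2 (U *m sqdiag_mx q l *m V^T) = fro2 (sqdiag_mx q l).
Proof. by move=> UU VV; rewrite fro2_isomr // fro2_isom. Qed.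

Lemma mxtrace_svd m n q (U1 U2 : 'M[R]_(m, q)) l1 l2 (V1 V2 : 'M[R]_(n, q)) :
  \tr ((U1 *m sqdiag_mx q l1 *m V1^T)^T *m (U2 *m sqdiag_mx q l2 *m V2^T)) =
  \sum_(j < q) \sum_(i < q) l2 j * l1 i * ((U1^T *m U2) i j * (V1^T *m V2) i j).
Proof.
have -> : \tr ((U1 *m sqdiag_mx q l1 *m V1^T)^T *m (U2 *m sqdiag_mx q l2 *m V2^T)) =
    \tr (sqdiag_mx q l1 *m (U1^T *m U2) *m sqdiag_mx q l2 *m (V1^T *m V2)^T).
  rewrite [(V1^T *m V2)^T]trmx_mul trmxK (mulmxA _ V2^T V1) [RHS]mxtrace_mulC.
  by rewrite !trmx_mul trmxK tr_sqdiag_mx !mulmxA.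
rewrite mxtrace_sqdiag; apply: eq_bigr => j _; rewrite mulr_sumr; apply: eq_bigr => i _.
by rewrite sqdiag_mxE; ring.
Qed.

(* The two diagonal blocks of the difference contribute at most as much as the
   two off-diagonal ones: with [P = U1^T U2] and [Q = V1^T V2], the defect is
   [2 * \sum_(i, j) l1_i l2_j (P_ij - Q_ij)^2]. *)
Lemma balanced_outer_dist m n q (U1 U2 : 'M[R]_(m, q)) l1 l2 (V1 V2 : 'M[R]_(n, q)) :
  U1^T *m U1 = 1%:M -> V1^T *m V1 = 1%:M -> (forall k, (k < q)%N -> 0 <= l1 k) ->
  U2^T *m U2 = 1%:M -> V2^T *m V2 = 1%:M -> (forall k, (k < q)%N -> 0 <= l2 k) ->
  fro2 (balanced U1 l1 V1 *m (balanced U1 l1 V1)^T -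
        balanced U2 l2 V2 *m (balanced U2 l2 V2)^T) <=
  4 * fro2 (U1 *m sqdiag_mx q l1 *m V1^T - U2 *m sqdiag_mx q l2 *m V2^T).
Proof.
move=> UU1 VV1 l10 UU2 VV2 l20; rewrite !balanced_outer //.
rewrite opp_block_mx add_block_mx fro2_block_mx.
have -> : fro2 (V1 *m sqdiag_mx q l1 *m U1^T - V2 *m sqdiag_mx q l2 *m U2^T) =
          fro2 (U1 *m sqdiag_mx q l1 *m V1^T - U2 *m sqdiag_mx q l2 *m V2^T).
  by rewrite -fro2_tr [_^T]linearB /= !trmx_mul !trmxK !tr_sqdiag_mx !mulmxA.
rewrite !fro2B !fro2_svd // !mxtrace_svd.
set P := U1^T *m U2; set Q := V1^T *m V2.
suff : 0 <= \sum_(j < q) \sum_(i < q) l2 j * l1 i * (P i j * P i j)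
     + \sum_(j < q) \sum_(i < q) l2 j * l1 i * (Q i j * Q i j)
     - 2 * \sum_(j < q) \sum_(i < q) l2 j * l1 i * (P i j * Q i j).
  by move: (\sum_j _) (\sum_j _) (\sum_j _) (fro2 _) (fro2 _) => *; lra.
rewrite mulr_sumr -sumrN -!big_split sumr_ge0 // => j _ /=.
rewrite mulr_sumr -sumrN -!big_split sumr_ge0 // => i _ /=.
have -> : l2 j * l1 i * (P i j * P i j) + l2 j * l1 i * (Q i j * Q i j)
    - 2 * (l2 j * l1 i * (P i j * Q i j)) = l2 j * l1 i * (P i j - Q i j) ^+ 2 by ring.
by rewrite mulr_ge0 ?sqr_ge0 // mulr_ge0 ?l10 ?l20.
Qed.

(** * Error of the truncated singular value decomposition *)

Lemma fro2_isom_card m q (V : 'M[R]_(m, q)) : V^T *m V = 1%:M -> fro2 V = q%:R.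
Proof. by move=> VV; rewrite /fro2 VV mxtrace1. Qed.

Lemma fro2_proj m q k (V : 'M[R]_(m, q)) (X : 'M[R]_(m, k)) : V^T *m V = 1%:M ->
  fro2 X = fro2 (V^T *m X) + fro2 ((1%:M - V *m V^T) *m X).
Proof.
move=> VV; rewrite mulmxBl mul1mx fro2B -mulmxA (fro2_isom _ VV).
have -> : \tr (X^T *m (V *m (V^T *m X))) = fro2 (V^T *m X).
  by rewrite /fro2 trmx_mul trmxK !mulmxA.
by ring.
Qed.

Lemma opnorm_proj m q (V : 'M[R]_(m, q)) : V^T *m V = 1%:M ->
  opnorm (1%:M - V *m V^T) <= 1.
Proof.
move=> VV; apply: opnorm_le => // x; rewrite mul1r !vnormE ler_wsqrtr //.
by rewrite [leRHS](fro2_proj _ VV) lerDr fro2_ge0.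
Qed.

(* Splitting along [Q = Vh Vh^T], the truncation error [X] satisfies
   [X Q = (Mh - M) Q] and [X (1 - Q) = - M (1 - Q)]; both parts have rank at most [q]. *)
Lemma truncated_svd_error m n q (M Mh : 'M[R]_(m, n)) Uh sh Vh
    (U : 'M[R]_(m, q)) l (V : 'M[R]_(n, q)) :
  (q <= minn m n)%N -> is_svd Mh Uh sh Vh ->
  U^T *m U = 1%:M -> M = U *m sqdiag_mx q l *m V^T ->
  fro2 (firstcols_mx q Uh *m sqdiag_mx q sh *m (firstcols_mx q Vh)^T - M) <=
  5 * q%:R * opnorm (Mh - M) ^+ 2.
Proof.
move=> qmn svdMh UU ME.
have := qmn; rewrite leq_min => /andP[qm qn].
rewrite -(svd_firstcols svdMh) //.
set W := firstcols_mx q Vh; set D := opnorm _.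
have WW : W^T *m W = 1%:M by apply: firstcols_mx_isom => //; case: svdMh.
have D0 : 0 <= D by exact: opnorm_ge0.
rewrite -fro2_tr (fro2_proj _ WW).
rewrite -[W in X in X + _](trmxK W) -![_^T *m _^T]trmx_mul trmxK fro2_tr.
have -> : (Mh *m W *m W^T - M) *m W = (Mh - M) *m W.
  by rewrite !mulmxBl -(mulmxA (Mh *m W)) WW mulmx1.
have QT : (1%:M - W *m W^T)^T = 1%:M - W *m W^T.
  by rewrite [LHS]linearB /= trmx1 trmx_mul trmxK.
rewrite -{1}QT -trmx_mul fro2_tr.
have -> : (Mh *m W *m W^T - M) *m (1%:M - W *m W^T) = - (M *m (1%:M - W *m W^T)).
  rewrite mulmxBl mulmxBr mulmx1 !mulmxA -(mulmxA (Mh *m W)) WW mulmx1 subrr.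
  by rewrite sub0r.
rewrite fro2N; set E := M *m (1%:M - W *m W^T).
(* The columns of [E] lie in the range of [U], so [E] can be traded for [E^T U], which has only [q]
   columns. *)
have EU : fro2 E = fro2 (E^T *m U).
  rewrite /E {1}ME -!mulmxA fro2_isom // -[RHS]fro2_tr trmx_mul trmxK.
  by rewrite ME !mulmxA UU mul1mx.
(* A Weyl-type bound: on the kernel of [V^T] the matrix [M] vanishes, so [Mh] acts there as
   [Mh - M]. If [q] is the full dimension, [sh q = 0]. *)
have shq : sh q <= D.
  have [mnq|qmn'] := leqP (minn m n) q.
    by case: svdMh => _ _ _ /(_ _ mnq) ->.
  have [x [x0 Vx]] := svd_constrained V^T svdMh (introT andP (conj (leqnn q) qmn')).
  have -> : Mh *m x = (Mh - M) *m x.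
    by rewrite mulmxBl ME -[_ *m V^T *m x]mulmxA Vx mulmx0 subr0.
  move=> /le_trans/(_ (vnorm_mulmx _ _)).
  by rewrite ler_pM2r // vnorm_gt0.
have opE : opnorm E <= 2 * D.
  have -> : E = Mh *m (1%:M - W *m W^T) + (M - Mh) *m (1%:M - W *m W^T).
    by rewrite mulmxBl addrC subrK.
  apply: le_trans (opnormD _ _) _; rewrite mulrDl !mul1r lerD //.
    by apply: le_trans (svd_tail svdMh qn) _.
  apply: le_trans (opnormM _ _) _.
  have -> : opnorm (M - Mh) = D by rewrite /D -opprB; apply: opnormN.
  by rewrite ler_piMr // opnorm_proj.
have E1 : fro2 E <= (2 * D) ^+ 2 * q%:R.
  rewrite EU; apply: le_trans (fro2_mulmx _ _) _; rewrite fro2_isom_card //.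
  rewrite ler_wpM2r // ler_sqr ?nnegrE ?opnorm_ge0 ?mulr_ge0 //.
  by apply: le_trans (opnorm_tr_le _) _.
have E2 : fro2 ((Mh - M) *m W) <= D ^+ 2 * q%:R.
  by rewrite -(fro2_isom_card WW) fro2_mulmx.
(* The constant 5 is [1 + 2^2], from the parts inside and outside the range of [W]. *)
apply: le_trans (lerD E2 E1) _.
by rewrite le_eqVlt; apply/orP; left; apply/eqP; ring.
Qed.

End Procrustes.

(** * Weighted factorizations *)

Section WeightedPerturbation.
Context {R : realType}.

Lemma posdef_mx_unit n (M : 'M[R]_n) : posdef_mx M -> M \in unitmx.
Proof.
move=> [_ Mpos]; rewrite -row_free_unit -kermx_eq0; apply/negPn/negP.
move=> /rowV0Pn[v /sub_kermxP vM v0].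
have := Mpos v^T; rewrite trmxK vM mul0mx mxE ltxx -trmx0 (inj_eq (@trmx_inj _ _ _)).
by move=> /(_ v0).
Qed.

Lemma opnorm_le0 m n (M : 'M[R]_(m, n)) : opnorm M <= 0 -> M = 0.
Proof.
move=> M0; apply/eqP; rewrite -fro2_eq0 eq_le fro2_ge0 andbT.
have := fro2_mulmx M 1%:M; rewrite mulmx1.
have -> : opnorm M = 0 by apply/eqP; rewrite eq_le M0 opnorm_ge0.
by rewrite expr0n mul0r.
Qed.

(** If the last of these singular values vanished, [svd_tail] would make [M] factor through its
    leading right singular vectors, one fewer than its rank. *)
Lemma singval_rank_gt0 m n (M : 'M[R]_(m, n)) q :
  (0 < q)%N -> \rank M = q -> 0 < singval M q.
Proof.
case: q => // q _ Mq; have [U [s [V [svdM ->]]]] /= := singval_svd M q.+1.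
have s0 : 0 <= s q by case: svdM => _ _ s_mono _ _; case: (s_mono q).
rewrite lt_def s0 andbT; apply/eqP => sq0.
have qn : (q <= n)%N by rewrite ltnW // -Mq rank_leq_col.
have := svd_tail svdM qn; rewrite sq0 => /opnorm_le0.
rewrite mulmxBr mulmx1 => /eqP; rewrite subr_eq0 => /eqP ME.
suff : (\rank M <= q)%N by rewrite Mq ltnn.
by rewrite ME mulmxA (leq_trans (mxrankM_maxr _ _)) // rank_leq_row.
Qed.

(** Courant-Fischer with the [q - 1] constraints that kill every coordinate of [V^T W x] except the
    [k]-th: on such [x] the middle factor only scales by [l k]. No order on [l] is assumed, so [k]
    is arbitrary. *)
Lemma singval_compress m n m' n' q (L : 'M[R]_(m, m')) (U : 'M[R]_(m', q)) l
    (V : 'M[R]_(n', q)) (W : 'M[R]_(n', n)) k :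
  (q <= minn m n)%N -> U^T *m U = 1%:M -> V^T *m V = 1%:M -> (k < q)%N -> 0 <= l k ->
  singval (L *m (U *m sqdiag_mx q l *m V^T) *m W) q <= opnorm L * l k * opnorm W.
Proof.
case: q U V => // q U V qmn UU VV kq lk0; set H := L *m _ *m W.
have [Uh [s [Vh [svdH ->]]]] /= := singval_svd H q.+1.
pose k' := Ordinal kq.
have [x [x0 Fx sx]] := svd_constrained (row' k' (V^T *m W)) svdH
  (introT andP (conj (leqnn q) qmn)).
rewrite -(ler_pM2r (vnorm_gt0 x0)); apply: le_trans sx _.
pose y := V^T *m (W *m x).
have yE : sqdiag_mx q.+1 l *m y = l k *: y.
  apply/matrixP => i j; rewrite sqdiag_mxE [RHS]mxE.
  have [i' ->|->//] := unliftP k' i.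
  suff -> : y (lift k' i') j = 0 by rewrite !mulr0.
  have /matrixP/(_ i' j) := Fx; rewrite [RHS]mxE => <-.
  by rewrite /y mulmxA !mxE; apply: eq_bigr => h _; rewrite [row' _ _ _ _]mxE.
have -> : H *m x = L *m (U *m (l k *: y)) by rewrite -yE /H /y !mulmxA.
apply: le_trans (vnorm_mulmx _ _) _.
rewrite -!mulrA ler_wpM2l ?opnorm_ge0 // -scalemxAr vnormZ ger0_norm //.
rewrite ler_wpM2l //; apply: le_trans _ (vnorm_mulmx _ _).
rewrite !vnormE ler_wsqrtr // (fro2_isom _ UU) [leRHS](fro2_proj _ VV).
by rewrite lerDl fro2_ge0.
Qed.

(** The Gram matrix of the balanced factor is [diag(2 l)], so [procrustes] applies with [2 c]. With
    the factors 4 of [balanced_outer_dist] and 5 of [truncated_svd_error], the constant is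
    [(3/4) * 4 * 5 = 15]. *)
Lemma balanced_perturbation m n q (M Mh : 'M[R]_(m, n)) Uh sh Vh
    (U : 'M[R]_(m, q)) l (V : 'M[R]_(n, q)) c :
  (q <= minn m n)%N -> is_svd Mh Uh sh Vh ->
  U^T *m U = 1%:M -> V^T *m V = 1%:M -> M = U *m sqdiag_mx q l *m V^T ->
  0 <= c -> (forall k, (k < q)%N -> c <= l k) ->
  exists2 T : 'M[R]_q, orthogonal_mx T &
    c * fro2 (balanced (firstcols_mx q Uh) sh (firstcols_mx q Vh) - balanced U l V *m T)
    <= 15 * q%:R * opnorm (Mh - M) ^+ 2.
Proof.
move=> qmn svdMh UU VV ME c0 cl.
have := qmn; rewrite leq_min => /andP[qm qn].
have [UhO VhO sh_mono _ _] := svdMh.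
have l0 k : (k < q)%N -> 0 <= l k by move=> /cl; exact: le_trans.
have sh0 k : (k < q)%N -> 0 <= sh k by case: (sh_mono k).
have cl2 k : (k < q)%N -> 2 * c <= 2 * l k by move=> /cl; rewrite ler_pM2l.
have [T TT le1] := procrustes (balanced (firstcols_mx q Uh) sh (firstcols_mx q Vh))
  (balanced_gram UU VV l0) cl2.
exists T => //.
have := le_trans le1 (balanced_outer_dist (firstcols_mx_isom qm UhO)
  (firstcols_mx_isom qn VhO) sh0 UU VV l0).
have := truncated_svd_error qmn svdMh UU ME; rewrite -ME.
by lra.
Qed.

(** Scalar bookkeeping for both bounds, with [a] and [b] the norms of the inverse weights:
    [s / (a b)] is the lower bound on [l], and the outer factor [a] comes from undoing one
    weight. *)
Lemma weighted_bound (n F D a b s w1 w2 h : R) :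
  0 < s -> 0 < a -> 0 < b -> 0 <= n -> 0 <= h -> 0 <= w1 -> 0 <= w2 -> 0 <= D ->
  D <= w1 * h * w2 -> s / (a * b) * F <= 15 * n * D ^+ 2 ->
  a * Num.sqrt F <=
  Num.sqrt (40 * n / s) * h * (w1 * w2 * a `^ (3 / 2) * b `^ (1 / 2)).
Proof.
move=> s0 a0 b0 n0 h0 w10 w20 D0 Dle Fle.
have [s0' a0' b0'] := And3 (ltW s0) (ltW a0) (ltW b0).
have -> : a `^ (3 / 2) = a * Num.sqrt a.
  have -> : 3 / 2 = 1 + 2^-1 :> R by field.
  rewrite powRD; last by rewrite gt_eqF ?implybT.
  by rewrite powRr1 // powR12_sqrt.
rewrite div1r powR12_sqrt //.
have -> : Num.sqrt (40 * n / s) * h * (w1 * w2 * (a * Num.sqrt a) * Num.sqrt b) =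
    a * (Num.sqrt (40 * n / s) * Num.sqrt a * Num.sqrt b * (w1 * h * w2)) by ring.
rewrite ler_wpM2l //.
have wh0 : 0 <= w1 * h * w2 by rewrite !mulr_ge0.
rewrite -[w1 * h * w2]ger0_norm // -sqrtr_sqr -!sqrtrM ?mulr_ge0 ?invr_ge0 //.
apply: ler_wsqrtr.
have FE : F <= 15 * n * D ^+ 2 * (a * b / s).
  rewrite -ler_pdivrMr ?divr_gt0 ?mulr_gt0 // invf_div mulrC //.
apply: le_trans FE _.
have -> : 40 * n / s * a * b * (w1 * h * w2) ^+ 2 =
  40 * n * (w1 * h * w2) ^+ 2 * (a * b / s) by ring.
rewrite ler_wpM2r ?divr_ge0 ?mulr_ge0 // ler_pM ?mulr_ge0 ?sqr_ge0 //.
  (* Here 15 is relaxed to 40. *)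
  by rewrite ler_wpM2r // ler_nat.
by rewrite ler_sqr.
Qed.

Lemma opnorm_le_sqrt m n (M : 'M[R]_(m, n)) F : fro2 M <= F -> opnorm M <= Num.sqrt F.
Proof. by move=> MF; apply: le_trans (opnorm_le_fro _) _; apply: ler_wsqrtr. Qed.

Lemma weighted_factor_perturbation m n q (H Hh : 'M[R]_(m, n)) (w1 : 'M[R]_m)
    (w2 : 'M[R]_n) Uh sh Vh (U : 'M[R]_(m, q)) l (V : 'M[R]_(n, q)) :
  (0 < q)%N -> \rank H = q -> w1 \in unitmx -> w2 \in unitmx ->
  is_svd (w1 *m Hh *m w2) Uh sh Vh ->
  U^T *m U = 1%:M -> V^T *m V = 1%:M -> (forall k, (k < q)%N -> 0 < l k) ->
  w1 *m H *m w2 = U *m sqdiag_mx q l *m V^T ->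
  let rt s := sqdiag_mx q (fun k => Num.sqrt (s k)) in
  let c := Num.sqrt (40 * q%:R / singval H q) * opnorm (Hh - H) in
  let a := opnorm (invmx w1) in let b := opnorm (invmx w2) in
  exists T : 'M[R]_q, orthogonal_mx T /\
    opnorm (invmx w1 *m firstcols_mx q Uh *m rt sh - invmx w1 *m U *m rt l *m T) <=
      c * (opnorm w1 * opnorm w2 * a `^ (3 / 2) * b `^ (1 / 2)) /\
    opnorm (rt sh *m (firstcols_mx q Vh)^T *m invmx w2 - T^T *m (rt l *m V^T *m invmx w2)) <=
      c * (opnorm w1 * opnorm w2 * b `^ (3 / 2) * a `^ (1 / 2)).
Proof.
move=> q0 rkH w1u w2u svdMh UU VV l0 ME rt c a b.
have qmn : (q <= minn m n)%N by rewrite leq_min -rkH rank_leq_row rank_leq_col.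
have sg0 := singval_rank_gt0 q0 rkH.
have HE : H = invmx w1 *m (U *m sqdiag_mx q l *m V^T) *m invmx w2.
  by rewrite -ME !mulmxA mulVmx // mul1mx mulmxK.
have a0 : 0 <= a by exact: opnorm_ge0.
have b0 : 0 <= b by exact: opnorm_ge0.
have sgl k : (k < q)%N -> singval H q <= a * l k * b.
  by move=> kq; rewrite {1}HE; apply: singval_compress => //; exact/ltW/l0.
(* Positivity of [a] and [b] follows from [0 < singval H q <= a * l 0 * b]. *)
have ab0 : 0 < a * b.
  have := lt_le_trans sg0 (sgl 0%N q0); rewrite mulrAC pmulr_lgt0 //; exact: l0.
have a1 : 0 < a by rewrite lt_def a0 andbT; apply: contraTneq ab0 => ->; rewrite mul0r ltxx.
have b1 : 0 < b by rewrite -(pmulr_rgt0 _ a1).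
have cl k : (k < q)%N -> singval H q / (a * b) <= l k.
  by move=> /sgl; rewrite ler_pdivrMr // mulrAC mulrC.
have [T TT] := balanced_perturbation qmn svdMh UU VV ME (divr_ge0 (ltW sg0) (ltW ab0)) cl.
have DE : opnorm (w1 *m Hh *m w2 - w1 *m H *m w2) <= opnorm w1 * opnorm (Hh - H) * opnorm w2.
  rewrite -mulmxBl -mulmxBr; apply: le_trans (opnormM _ _) _.
  by rewrite ler_wpM2r ?opnorm_ge0 // opnormM.
rewrite /balanced mul_col_mx opp_col_mx add_col_mx fro2_col_mx.
set Du := _ - U *m _ *m T; set Dv := _ - V *m _ *m T => le15.
(* [le15] bounds the sum of both squared errors, so each block inherits it with the same [T]. *)
have F0 := (fro2_ge0 Du, fro2_ge0 Dv).
exists T; split => //; split.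
  have -> : invmx w1 *m firstcols_mx q Uh *m rt sh - invmx w1 *m U *m rt l *m T =
      invmx w1 *m Du by rewrite mulmxBr !mulmxA.
  apply: le_trans (opnormM _ _) _.
  apply: le_trans _ (weighted_bound sg0 a1 b1 _ _ _ _ _ DE le15); rewrite ?opnorm_ge0 //.
  by rewrite ler_wpM2l // opnorm_le_sqrt // lerDl F0.
have -> : rt sh *m (firstcols_mx q Vh)^T *m invmx w2 - T^T *m (rt l *m V^T *m invmx w2) =
    Dv^T *m invmx w2.
  rewrite /Dv [(_ - _)^T]linearB /= mulmxBl !trmx_mul !tr_sqdiag_mx.
  by rewrite !mulmxA.
apply: le_trans (opnormM _ _) _; rewrite [leLHS]mulrC.
(* For the right factor the two weights exchange roles. *)
rewrite [a * b]mulrC in le15.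
apply: le_trans _ (weighted_bound sg0 b1 a1 _ _ _ _ _ DE le15); rewrite ?opnorm_ge0 //.
by rewrite ler_wpM2l // opnorm_le_sqrt // fro2_tr lerDr F0.
Qed.

End WeightedPerturbation.

Theorem theorem3
  (R : realType) (d : measure_display) (Om : measurableType d)
  (P : probability Om R)
  (nx nu ny f p N : nat)
  (A : 'M[R]_nx) (B : 'M[R]_(nx, nu)) (C : 'M[R]_(ny, nx)) (K : 'M[R]_(nx, ny))
  (Sigma_e S : 'M[R]_ny) (sigma_u beta : R)
  (e : nat -> 'I_ny -> {RV P >-> R}) (u : nat -> 'I_nu -> {RV P >-> R})
  (W1 : Om -> 'M[R]_(f * ny)) (W2 : Om -> 'M[R]_(p * (ny + nu))) :
  (* dimensions *)
  (0 < nx)%N -> (0 < nu)%N -> (0 < ny)%N -> (0 < f)%N ->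
  (* standing assumptions on the system *)
  schur_stable A -> schur_stable (A - K *m C) ->
  controllable A (row_mx B K) -> observable A C ->
  posdef_mx Sigma_e -> posdef_mx S -> S *m S = Sigma_e ->   (* S = Sigma_e^{1/2} *)
  0 < sigma_u ->
  (* e_k ~ N(0, I), u_k ~ N(0, sigma_u^2 I), all (k >= 1) mutually independent *)
  (forall k j, (1 <= k)%N -> has_normal_law (e k j) 0 1) ->
  (forall k j, (1 <= k)%N -> has_normal_law (u k j) 0 sigma_u) ->
  mutually_independent P
    (fun ix : (nat * 'I_ny) + (nat * 'I_nu) =>
       match ix with inl (k, j) => (e k j : Om -> R) | inr (k, j) => (u k j : Om -> R) end)
    [set ix | match ix with inl (k, _) => (1 <= k)%N | inr (k, _) => (1 <= k)%N end] ->
  (* H_fp has rank n_x *)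
  \rank (Hfp f p A B C K) = nx ->
  (* weights almost surely positive definite *)
  {ae P, forall om, posdef_mx (W1 om) /\ posdef_mx (W2 om)} ->
  (* p = beta log N, with beta large enough *)
  p%:R = beta * ln N%:R ->
  opnorm (C *m (A - K *m C) ^+ p) *
    opnorm (Sigmax P A B K S (fun k j => e k j : Om -> R) (fun k j => u k j : Om -> R) N)
    <= (N%:R ^+ 3)^-1 ->
  forall delta : R, 0 < delta < 1 ->
  (forall i, (1 <= i <= f)%N ->
     nat_ge_min N (Npe_set P A B C K S sigma_u
                 (fun k j => e k j : Om -> R) (fun k j => u k j : Om -> R)
                 p i (delta / (9 * f%:R)))) ->
  exists E : set Om, measurable E /\ ((1 - 2 * delta)%:E <= P E)%E /\
  forall om, E om ->
  let Hh := Hhat A B C K S (fun k j => e k j : Om -> R) (fun k j => u k j : Om -> R)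
              N f p om in
  let H := Hfp f p A B C K in
  let w1 := W1 om in let w2 := W2 om in
  opnorm (w1 *m Hh *m w2 - w1 *m H *m w2) <= singval (w1 *m H *m w2) nx / 4 ->
  (* any SVD of the weighted estimate, truncated to the n_x leading terms *)
  forall (Uh : 'M[R]_(f * ny)) (sh : nat -> R) (Vh : 'M[R]_(p * (ny + nu))),
  is_svd (w1 *m Hh *m w2) Uh sh Vh ->
  (* any compact SVD of the weighted true matrix *)
  forall (U1 : 'M[R]_(f * ny, nx)) (l : nat -> R) (V1 : 'M[R]_(p * (ny + nu), nx)),
  U1^T *m U1 = 1%:M -> V1^T *m V1 = 1%:M -> (forall k, (k < nx)%N -> 0 < l k) ->
  w1 *m H *m w2 = U1 *m sqdiag_mx nx l *m V1^T ->
  let Gammahat := invmx w1 *m firstcols_mx nx Uh *m sqdiag_mx nx (fun k => Num.sqrt (sh k)) in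
  let Lhat := sqdiag_mx nx (fun k => Num.sqrt (sh k)) *m (firstcols_mx nx Vh)^T *m invmx w2 in
  let Gammabar := invmx w1 *m U1 *m sqdiag_mx nx (fun k => Num.sqrt (l k)) in
  let Lbar := sqdiag_mx nx (fun k => Num.sqrt (l k)) *m V1^T *m invmx w2 in
  let WG := opnorm w1 * opnorm w2 * opnorm (invmx w1) `^ (3 / 2)
            * opnorm (invmx w2) `^ (1 / 2) in
  let WL := opnorm w1 * opnorm w2 * opnorm (invmx w2) `^ (3 / 2)
            * opnorm (invmx w1) `^ (1 / 2) in
  let c := Num.sqrt (40 * nx%:R / singval H nx) * opnorm (Hh - H) in
  exists T : 'M[R]_nx, orthogonal_mx T /\
    opnorm (Gammahat - Gammabar *m T) <= c * WG /\
    opnorm (Lhat - T^T *m Lbar) <= c * WL.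
Proof.
move=> nx0 _ _ _ _ _ _ _ _ _ _ _ _ _ _ rkH [A0 [mA0 PA0 sub]] _ _ delta /andP[d0 _] _.
(* [A0] is a measurable null set containing every outcome at which a weight fails to be positive
   definite; its complement has probability 1. *)
exists (~` A0); split; first exact: measurableC.
split; first by rewrite probability_setC // PA0 sube0 lee_fin gerBl mulr_ge0 // ltW.
move=> om EOm Hh H w1 w2 _ Uh sh Vh svdMh U1 l V1 UU VV l0 ME.
have [pd1 pd2] : posdef_mx w1 /\ posdef_mx w2.
  by apply: contrapT => npd; apply: EOm; apply: sub.
exact: weighted_factor_perturbation nx0 rkH (posdef_mx_unit pd1) (posdef_mx_unit pd2)
  svdMh UU VV l0 ME.
Qed.
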